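(* The $\Gamma$-limit $F_0$ of the functionals $F_\varepsilon$ as $\varepsilon\to0^+$ with respect to weak convergence in $W^{1,2}(\Omega_1;\mathbb{R}^3)\times L^2(\mathbb{R}^3;\mathbb{R}^3)$ can be expressed equivalently as $$\tilde F_0[m,h]=\begin{cases}\displaystyle\int_\omega\alpha|\nabla m|^2+\varphi(m)+\frac12m_3^2\,dx,&\text{if }(m,h)\in\tilde{\mathcal{U}}_0,\\ \infty,&\text{otherwise,}\end{cases}$$ where $$\tilde{\mathcal{U}}_0=\{(m,h)\in W^{1,2}(\omega;\mathbb{R}^3)\times L^2(\mathbb{R}^2;\mathbb{R}^3):\ |m|=m_s\text{ a.e. in }\omega,\ h=-(0,0,m_3)^T\}$$ (with $m_3$ extended by zero to $\mathbb{R}^2$), and $(m,h)\in\tilde{\mathcal{U}}_0$ is identified with the pair in $W^{1,2}(\Omega_1;\mathbb{R}^3)\times L^2(\mathbb{R}^3;\mathbb{R}^3)$ given by $(x',x_3)\mapsto m(x')$ on $\Omega_1$ and by $(x',x_3)\mapsto h(x')$ for $x_3\in(0,1)$, $0$ for $x_3\notin(0,1)$. That is, under this identification $\mathcal{U}_0=\tilde{\mathcal{U}}_0$, and $F_0=\tilde F_0$.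
   Context: Let $\omega\subset\mathbb{R}^2$ be a bounded domain with $|\omega|=1$, and $\Omega_1=\omega\times(0,1)\subset\mathbb{R}^3$. Let $\alpha>0$, $m_s>0$, and let $\varphi:\mathbb{R}^3\to[0,\infty)$ be continuous and even. Write $\nabla'=(\partial_1,\partial_2)^T$ and, for $\varepsilon>0$, $\nabla_\varepsilon=(\partial_1,\partial_2,\frac1\varepsilon\partial_3)^T$, $\mathrm{div}_\varepsilon=\nabla_\varepsilon\cdot$, $\mathrm{curl}_\varepsilon=\nabla_\varepsilon\times$. All derivatives are distributional; in equations on $\mathbb{R}^3$ a function $m:\Omega_1\to\mathbb{R}^3$ is identified with its extension by zero to $\mathbb{R}^3$. For $\varepsilon>0$ let $\mathcal{U}_\varepsilon$ be the set of all $(m,h)\in W^{1,2}(\Omega_1;\mathbb{R}^3)\times L^2(\mathbb{R}^3;\mathbb{R}^3)$ with $\mathrm{div}_\varepsilon(m+h)=0$ and $\mathrm{curl}_\varepsilon h=0$ in $\mathbb{R}^3$, and $|m|=m_s$ a.e. in $\Omega_1$, and let $$F_\varepsilon[m,h]=\int_{\Omega_1}\alpha|\nabla_\varepsilon m|^2+\varphi(m)\,dx+\frac12\int_{\mathbb{R}^3}|h|^2\,dx\ \text{ if }(m,h)\in\mathcal{U}_\varepsilon,\qquad F_\varepsilon[m,h]=\infty\ \text{ otherwise.}$$ Its $\Gamma$-limit is $$F_0[m,h]=\int_{\Omega_1}\alpha|\nabla' m|^2+\varphi(m)\,dx+\frac12\int_{\mathbb{R}^3}|h|^2\,dx\ \text{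 if }(m,h)\in\mathcal{U}_0,\qquad F_0[m,h]=\infty\ \text{ otherwise,}$$ where $\mathcal{U}_0$ is the set of all $(m,h)\in W^{1,2}(\Omega_1;\mathbb{R}^3)\times L^2(\mathbb{R}^3;\mathbb{R}^3)$ with $\partial_3(m_3+h_3)=0$, $\partial_3h_2=0$, $\partial_3h_1=0$, $\partial_1h_2-\partial_2h_1=0$ in $\mathbb{R}^3$, $\partial_3m=0$ in $\Omega_1$, and $|m|=m_s$ a.e. in $\Omega_1$. $\Gamma$-limit with respect to weak convergence means, for all sequences $\varepsilon_j\to0^+$ and all $(m,h)$: (1) $\liminf_jF_{\varepsilon_j}[m_j,h_j]\ge F_0[m,h]$ whenever $m_j\rightharpoonup m$ in $W^{1,2}(\Omega_1;\mathbb{R}^3)$ and $h_j\rightharpoonup h$ in $L^2(\mathbb{R}^3;\mathbb{R}^3)$; (2) there exist $m_j\rightharpoonup m$ and $h_j\rightharpoonup h$ in these spaces with $\lim_jF_{\varepsilon_j}[m_j,h_j]=F_0[m,h]$. *)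

(* Defs.v *)
From HB Require Import structures.
From mathcomp Require Import all_boot all_order all_algebra.
From mathcomp Require Import all_classical all_reals all_analysis.
From mathcomp Require Import measurable_realfun.
Set Implicit Arguments.
Unset Strict Implicit.
Unset Printing Implicit Defensive.
Import Order.TTheory GRing.Theory Num.Theory.
Import numFieldNormedType.Exports.
Local Open Scope classical_set_scope.
Local Open Scope ring_scope.

(* Points are nested pairs, for which product measures are available:
   x : space R is (x', x_3) with x' = x.1 : plane R and x_3 = x.2.
   Values of m and h are row vectors 'rV[R]_3. *)
Notation plane R := (Real.sort R * Real.sort R)%type.
Notation space R := (Real.sort R * Real.sort R * Real.sort R)%type.

Notation field2 R := (plane R -> 'rV[R]_3).
Notation field3 R := (space R -> 'rV[R]_3).

(* measurableTypeR R is the carrier R with the sigma-algebra on which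
   lebesgue_measure is defined. *)
Definition leb2 (R : realType) :
    set (measurableTypeR R * measurableTypeR R)%type -> \bar R :=
  (@lebesgue_measure R \x @lebesgue_measure R)%E.
HB.instance Definition _ (R : realType) := Measure.on (@leb2 R).

Definition leb3 (R : realType) :
    set (measurableTypeR R * measurableTypeR R * measurableTypeR R)%type ->
    \bar R :=
  (@leb2 R \x @lebesgue_measure R)%E.
HB.instance Definition _ (R : realType) := Measure.on (@leb3 R).

Arguments leb2 R : clear implicits.
Arguments leb3 R : clear implicits.

Definition k1 : 'I_3 := @Ordinal 3 0 isT.
Definition k2 : 'I_3 := @Ordinal 3 1 isT.
Definition k3 : 'I_3 := @Ordinal 3 2 isT.

Definition e2 (R : realType) (i : 'I_2) : plane R :=
  ((i == 0%N :> nat)%:R, (i == 1%N :> nat)%:R).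

Definition e3 (R : realType) (i : 'I_3) : space R :=
  ((i == k1)%:R, (i == k2)%:R, (i == k3)%:R).

(* The norm of the normed module 'rV[R]_3 is the maximum norm. *)
Definition enorm (R : realType) (v : 'rV[R]_3) : R :=
  Num.sqrt (\sum_(j < 3) v 0 j ^+ 2).

Fixpoint Ck (R : realType) (V : normedModType R) (n : nat) (e : 'I_n -> V)
    (k : nat) (f : V -> R) : Prop :=
  match k with
  | 0 => continuous f
  | k'.+1 => continuous f /\
      forall i, (forall x, derivable f x (e i)) /\
                Ck e k' (fun x => 'D_(e i) f x)
  end.

Definition test_function (R : realType) (V : normedModType R) (n : nat)
    (e : 'I_n -> V) (Om : set V) (psi : V -> R) : Prop :=
  (forall k, Ck e k psi) /\
  exists K : set V, [/\ compact K, K `<=` Om & forall x, ~ K x -> psi x = 0].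

Definition test2 (R : realType) : set (plane R) -> (plane R -> R) -> Prop :=
  test_function (@e2 R).

Definition test3 (R : realType) : set (space R) -> (space R -> R) -> Prop :=
  test_function (@e3 R).

(* The value at psi of the distribution D_i f on Om. *)
Definition distr_der2 (R : realType) (Om : set (plane R)) (i : 'I_2)
    (f psi : plane R -> R) : R :=
  - \int[leb2 R]_(x in Om) (f x * 'D_(e2 R i) psi x).

Definition distr_der3 (R : realType) (Om : set (space R)) (i : 'I_3)
    (f psi : space R -> R) : R :=
  - \int[leb3 R]_(x in Om) (f x * 'D_(e3 R i) psi x).

Definition weak_der2 (R : realType) (Om : set (plane R)) (i : 'I_2)
    (f g : plane R -> R) : Prop :=
  forall psi, test2 Om psi ->
    distr_der2 Om i f psi = \int[leb2 R]_(x in Om) (g x * psi x).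

Definition weak_der3 (R : realType) (Om : set (space R)) (i : 'I_3)
    (f g : space R -> R) : Prop :=
  forall psi, test3 Om psi ->
    distr_der3 Om i f psi = \int[leb3 R]_(x in Om) (g x * psi x).

(* Elements of the function spaces are represented by functions defined
    everywhere, of which only the values in Om matter, up to a.e. equality. *)

Definition L2 (R : realType) (d : measure_display) (T : measurableType d)
    (mu : {measure set T -> \bar R}) (Om : set T) (f : T -> R) : Prop :=
  measurable_fun Om f /\ (\int[mu]_(x in Om) (f x ^+ 2)%:E < +oo)%E.

Definition L2vec (R : realType) (d : measure_display) (T : measurableType d)
    (mu : {measure set T -> \bar R}) (Om : set T) (h : T -> 'rV[R]_3) : Prop :=
  forall j, L2 mu Om (fun x => h x 0 j).

(* wd i f g stands for "g is the i-th weak derivative of f in Om". *)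
Definition W12vec (R : realType) (d : measure_display) (T : measurableType d)
    (mu : {measure set T -> \bar R}) (Om : set T) (n : nat)
    (wd : 'I_n -> (T -> R) -> (T -> R) -> Prop) (m : T -> 'rV[R]_3) : Prop :=
  L2vec mu Om m /\
  forall i j, exists2 g, L2 mu Om g & wd i (fun x => m x 0 j) g.

(* Weak derivatives are unique up to a.e. equality; one representative is
   chosen (the default 0 is not used on functions of W^{1,2}). *)
Definition wpartial (R : realType) (d : measure_display) (T : measurableType d)
    (mu : {measure set T -> \bar R}) (Om : set T) (n : nat)
    (wd : 'I_n -> (T -> R) -> (T -> R) -> Prop) (i : 'I_n) (f : T -> R) :
    T -> R :=
  xget (fun=> 0) [set g | L2 mu Om g /\ wd i f g].

Definition W12_2 (R : realType) (om : set (plane R)) : field2 R -> Prop :=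
  W12vec (leb2 R) om (weak_der2 om).

Definition W12_3 (R : realType) (Om : set (space R)) : field3 R -> Prop :=
  W12vec (leb3 R) Om (weak_der3 Om).

(* pd2 om m i j = D_i m_j, the weak derivative in om. *)
Definition pd2 (R : realType) (om : set (plane R)) (m : field2 R)
    (i : 'I_2) (j : 'I_3) : plane R -> R :=
  wpartial (leb2 R) om (weak_der2 om) i (fun x => m x 0 j).

Definition pd3 (R : realType) (Om : set (space R)) (m : field3 R)
    (i : 'I_3) (j : 'I_3) : space R -> R :=
  wpartial (leb3 R) Om (weak_der3 Om) i (fun x => m x 0 j).

Definition slab (R : realType) (om : set (plane R)) : set (space R) :=
  om `*` `]0, 1[%classic.

Definition ext0 (R : realType) (T : Type) (Om : set T) (m : T -> 'rV[R]_3) :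
    T -> 'rV[R]_3 :=
  fun x => if x \in Om then m x else 0.

(* Pairs are (m, h). *)
Definition X3 (R : realType) (om : set (plane R)) :
    set (field3 R * field3 R) :=
  [set p | W12_3 (slab om) p.1 /\ L2vec (leb3 R) setT p.2].

(* D_i f, as a distribution on the whole space. *)
Definition dd (R : realType) (i : 'I_3) (f : space R -> R) :
    (space R -> R) -> R := distr_der3 setT i f.

Definition div_eps_free (R : realType) (eps : R) (b : field3 R) : Prop :=
  forall psi, test3 setT psi ->
    dd k1 (fun x => b x 0 k1) psi + dd k2 (fun x => b x 0 k2) psi
    + eps^-1 * dd k3 (fun x => b x 0 k3) psi = 0.

Definition curl_eps_free (R : realType) (eps : R) (h : field3 R) : Prop :=
  forall psi, test3 setT psi ->
    [/\ dd k2 (fun x => h x 0 k3) psi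
          - eps^-1 * dd k3 (fun x => h x 0 k2) psi = 0,
        eps^-1 * dd k3 (fun x => h x 0 k1) psi
          - dd k1 (fun x => h x 0 k3) psi = 0 &
        dd k1 (fun x => h x 0 k2) psi - dd k2 (fun x => h x 0 k1) psi = 0].

Definition U_eps (R : realType) (om : set (plane R)) (ms eps : R) :
    set (field3 R * field3 R) :=
  [set p | [/\ X3 om p,
     div_eps_free eps (fun x => ext0 (slab om) p.1 x + p.2 x),
     curl_eps_free eps p.2 &
     {ae leb3 R, forall x, slab om x -> enorm (p.1 x) = ms}]].

Definition F_eps (R : realType) (om : set (plane R)) (alpha ms : R)
    (phi : 'rV[R]_3 -> R) (eps : R) (p : field3 R * field3 R) : \bar R :=
  if `[< U_eps om ms eps p >] then
    (\int[leb3 R]_(x in slab om)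
       (alpha * (\sum_(j < 3) (pd3 (slab om) p.1 k1 j x ^+ 2
                               + pd3 (slab om) p.1 k2 j x ^+ 2
                               + (eps^-1 * pd3 (slab om) p.1 k3 j x) ^+ 2))
        + phi (p.1 x))%:E
     + (2^-1)%:E * \int[leb3 R]_x (enorm (p.2 x) ^+ 2)%:E)%E
  else +oo%E.

Definition U_0 (R : realType) (om : set (plane R)) (ms : R) :
    set (field3 R * field3 R) :=
  [set p | [/\ X3 om p,
     forall psi, test3 setT psi ->
       [/\ dd k3 (fun x => ext0 (slab om) p.1 x 0 k3 + p.2 x 0 k3) psi = 0,
           dd k3 (fun x => p.2 x 0 k2) psi = 0,
           dd k3 (fun x => p.2 x 0 k1) psi = 0 &
           dd k1 (fun x => p.2 x 0 k2) psi
             - dd k2 (fun x => p.2 x 0 k1) psi = 0],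
     forall psi, test3 (slab om) psi ->
       forall j, distr_der3 (slab om) k3 (fun x => p.1 x 0 j) psi = 0 &
     {ae leb3 R, forall x, slab om x -> enorm (p.1 x) = ms}]].

Definition F_0 (R : realType) (om : set (plane R)) (alpha ms : R)
    (phi : 'rV[R]_3 -> R) (p : field3 R * field3 R) : \bar R :=
  if `[< U_0 om ms p >] then
    (\int[leb3 R]_(x in slab om)
       (alpha * (\sum_(j < 3) (pd3 (slab om) p.1 k1 j x ^+ 2
                               + pd3 (slab om) p.1 k2 j x ^+ 2))
        + phi (p.1 x))%:E
     + (2^-1)%:E * \int[leb3 R]_x (enorm (p.2 x) ^+ 2)%:E)%E
  else +oo%E.

Definition X2 (R : realType) (om : set (plane R)) :
    set (field2 R * field2 R) :=
  [set q | W12_2 om q.1 /\ L2vec (leb2 R) setT q.2].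

Definition tU_0 (R : realType) (om : set (plane R)) (ms : R) :
    set (field2 R * field2 R) :=
  [set q | [/\ X2 om q,
     {ae leb2 R, forall x, om x -> enorm (q.1 x) = ms} &
     {ae leb2 R, forall x,
       q.2 x = \row_j (if j == k3 then - ext0 om q.1 x 0 k3 else 0)}]].

Definition tF_0 (R : realType) (om : set (plane R)) (alpha ms : R)
    (phi : 'rV[R]_3 -> R) (q : field2 R * field2 R) : \bar R :=
  if `[< tU_0 om ms q >] then
    (\int[leb2 R]_(x in om)
       (alpha * (\sum_(i < 2) \sum_(j < 3) pd2 om q.1 i j x ^+ 2)
        + phi (q.1 x) + 2^-1 * q.1 x 0 k3 ^+ 2)%:E)%E
  else +oo%E.

Definition identified (R : realType) (om : set (plane R))
    (q : field2 R * field2 R) (p : field3 R * field3 R) : Prop :=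
  {ae leb3 R, forall x, slab om x -> p.1 x = q.1 x.1} /\
  {ae leb3 R, forall x, p.2 x = if 0 < x.2 < 1 then q.2 x.1 else 0}.

(* The image of A in W^{1,2} x L^2 under the identification; it is closed
   under a.e. equality, as sets of representatives have to be. *)
Definition embed (R : realType) (om : set (plane R))
    (A : set (field2 R * field2 R)) : set (field3 R * field3 R) :=
  [set p | X3 om p /\ exists2 q, A q & identified om q p].

(* tF_0 as a functional on the three-dimensional space, +oo at the pairs which
   are not identified with a two-dimensional one.  The chosen q is unique up
   to a.e. equality. *)
Definition tF_0_embed (R : realType) (om : set (plane R)) (alpha ms : R)
    (phi : 'rV[R]_3 -> R) (p : field3 R * field3 R) : \bar R :=
  match pselect (exists q, X2 om q /\ identified om q p) with
  | left e => tF_0 om alpha ms phi (projT1 (cid e))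
  | right _ => +oo%E
  end.

Definition W12norm3 (R : realType) (Om : set (space R)) (m : field3 R) : R :=
  Num.sqrt (\sum_(j < 3)
    (\int[leb3 R]_(x in Om) (m x 0 j ^+ 2)
     + \sum_(i < 3) \int[leb3 R]_(x in Om) (pd3 Om m i j x ^+ 2))).

Definition L2norm3 (R : realType) (h : field3 R) : R :=
  Num.sqrt (\sum_(j < 3) \int[leb3 R]_x (h x 0 j ^+ 2)).

(* u_j -> l weakly in the space X with norm N: convergence against all
   bounded linear functionals ell on X.  (Boundedness makes ell invariant
   under a.e. equality.) *)
Definition weakly_cvg (R : realType) (X : field3 R -> Prop) (N : field3 R -> R)
    (u : nat -> field3 R) (l : field3 R) : Prop :=
  forall ell : field3 R -> R,
    (forall (a : R) (f g : field3 R), X f -> X g ->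
       ell (fun x => a *: f x + g x) = a * ell f + ell g) ->
    (exists C : R, forall f, X f -> `|ell f| <= C * N f) ->
    (fun j => ell (u j)) @ \oo --> ell l.

Definition weakly_cvg_pair (R : realType) (om : set (plane R))
    (u : nat -> field3 R * field3 R) (p : field3 R * field3 R) : Prop :=
  weakly_cvg (W12_3 (slab om)) (W12norm3 (slab om)) (fun j => (u j).1) p.1 /\
  weakly_cvg (L2vec (leb3 R) setT) (@L2norm3 R) (fun j => (u j).2) p.2.

Definition Gamma_limit (R : realType) (om : set (plane R))
    (Feps : R -> field3 R * field3 R -> \bar R)
    (F : field3 R * field3 R -> \bar R) : Prop :=
  forall eps : nat -> R, (forall j, 0 < eps j) -> eps @ \oo --> (0 : R) ->
  forall p, X3 om p ->
    (forall u, (forall j, X3 om (u j)) -> weakly_cvg_pair om u p ->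
       (F p <= limn_einf (fun j => Feps (eps j) (u j)))%E) /\
    (exists u, [/\ forall j, X3 om (u j), weakly_cvg_pair om u p &
       (fun j => Feps (eps j) (u j)) @ \oo --> F p]).

(* Main.v *)
Require Import Defs.
From HB Require Import structures.
From mathcomp Require Import all_boot all_order all_algebra.
From mathcomp Require Import all_classical all_reals all_analysis.
From mathcomp Require Import measurable_realfun.
From mathcomp Require Import ring lra.
Set Implicit Arguments.
Unset Strict Implicit.
Unset Printing Implicit Defensive.
Import Order.TTheory GRing.Theory Num.Theory.
Import numFieldNormedType.Exports.
Local Open Scope classical_set_scope.
Local Open Scope ring_scope.

(** The limit functional sees only pairs (m, h) whose distributional equations
    force m to be constant in x_3 and h to be the vertical field
    -(0, 0, m_3) 1_slab; everything else is bookkeeping.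

    Two facts on a function f in L^2 whose weak third derivative vanishes carry
    the proof.  For a test function A of x' and test functions b, c of x_3, the
    function (int c) b - (int b) c has integral zero, hence is the derivative
    of a test function, so that
      (int c) (int f (A b)) = (int b) (int f (A c))
    (vanishing_d3_exchange).
    - In the slab one fixes c of integral 1 and puts
      q(x') = int f(x', t) c(t) dt: then f - q integrates to zero against all
      products A b, hence f(x', x_3) = q(x') almost everywhere (slab_cylinder).
    - In the whole space one takes for c cut-off functions c_n with 0 <= c_n <= 1
      and S_n = int c_n -> oo.  By Cauchy-Schwarz
      (int f (A c_n))^2 <= C S_n, so S_n (int f (A b))^2 is bounded and
      int f (A b) = 0: f vanishes almost everywhere
      (vanishing_d3_whole_space).
    Both rest on the fundamental lemma of the calculus of variations for
    products of one-dimensional cut-off functions (cutoff_integrals_eq0).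

    For (m, h) in U_0 the second fact applies to h_1, h_2 and m_3 + h_3
    (U_0_field), the first one to the components of m and to their horizontal
    weak derivatives, whose third derivative vanishes as well
    (U_0_cylinder); conversely, a cylindrical m has vanishing third derivative
    by Fubini (cylinder_d3).  By uniqueness of weak derivatives the horizontal
    derivatives of m in the slab are those of its trace in om (pd3_pd2), and
    integration over x_3 in (0, 1) identifies the energies (F_0_tF_0).  The two
    notions of Gamma-limit evaluate the limit functional only on the space X3,
    where both functionals agree. *)

Local Notation space R := (Defs.space R).
(* The same carriers with the sigma-algebras on which leb2 and leb3 live. *)
Local Notation mplane R := (measurableTypeR R * measurableTypeR R)%type.
Local Notation mspace R := (mplane R * measurableTypeR R)%type.

(** * Smooth cut-off functions of one variable *)

Lemma is_derive_cvg (R : realType) (V W : normedModType R) (f : V -> W)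
    (x v : V) (l : W) :
  h^-1 *: (f (h *: v + x) - f x) @[h --> 0^'] --> l <-> is_derive x v f l.
Proof.
split=> [fl|[+ <-]]; last by [].
by split; [exact: (cvgP l)|exact: cvg_lim].
Qed.

Section smooth_functions_of_one_variable.
Variable R : realType.
Implicit Types (f g : R -> R) (k : nat) (P : {poly R}).

(** f is k times differentiable on the line. *)
Fixpoint Dn k f : Prop :=
  if k is k'.+1 then
    exists2 f' : R -> R, (forall x : R, is_derive x (1 : R) f (f' x)) & Dn k' f'
  else True.

(** Infinitely differentiable functions of one variable. *)
Definition smooth1 f : Prop := forall k, Dn k f.

Lemma DnS k f : Dn k.+1 f -> Dn k f.
Proof.
elim: k f => [//|k IH] f [f' df Df']; exists f' => //; exact: IH.
Qed.

Lemma DnD k f g : Dn k f -> Dn k g -> Dn k (f \+ g).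
Proof.
elim: k f g => [//|k IH] f g [f' df Df'] [g' dg Dg'].
exists (f' \+ g'); last exact: IH.
by move=> x; exact: is_deriveD.
Qed.

Lemma DnZ k (c : R) f : Dn k f -> Dn k (fun x => c * f x).
Proof.
elim: k f => [//|k IH] f [f' df Df'].
exists (fun x => c * f' x); last exact: IH.
by move=> x; exact: (is_deriveZ c).
Qed.

Lemma DnM k f g : Dn k f -> Dn k g -> Dn k (f \* g).
Proof.
elim: k f g => [//|k IH] f g Df Dg.
have [f' df Df'] := Df; have [g' dg Dg'] := Dg.
exists ((f' \* g) \+ (f \* g')); last by apply: DnD; apply: IH => //; exact: DnS.
by move=> x; apply: is_derive_eq; rewrite /GRing.scale/= addrC mulrC.
Qed.

Lemma Dn_affine k f (a b : R) : Dn k f -> Dn k (fun x => f (a * x + b)).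
Proof.
elim: k f => [//|k IH] f [f' df Df'].
exists (fun x => a * f' (a * x + b)); last by apply: DnZ; exact: IH.
move=> x; have h : is_derive x 1 (fun x => a * x + b) a.
  by apply: is_derive_eq; rewrite /GRing.scale/= mulr1 addr0.
by rewrite mulrC; exact: is_derive1_comp.
Qed.

Lemma smooth1_continuous f : smooth1 f -> continuous f.
Proof.
move=> /(_ 1%N)[f' df _] x; apply: differentiable_continuous.
by apply/derivable1_diffP; have [] := df x.
Qed.

Lemma smooth1_derivable f x : smooth1 f -> derivable f x 1.
Proof. by move=> /(_ 1%N)[f' df _]; have [] := df x. Qed.

Lemma smooth1_derive f : smooth1 f -> smooth1 ('D_1 f).
Proof.
move=> sf k; have [f' df Df'] := sf k.+1.
by rewrite (_ : 'D_1 f = f')//; apply/funext => x; exact: derive_val.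
Qed.

Lemma pow_expR_bounded (s : R) (n : nat) : 0 < s ->
  exists C, forall y : R, 0 < y -> y ^+ n.+1 * expR (- (s * y)) <= C.
Proof.
move=> s0; exists (n.+1`!%:R / s ^+ n.+1) => y y0.
have := @expR_ge1Dxn R (s * y) n (ltW (mulr_gt0 s0 y0)).
move=> h; have {}h : (s * y) ^+ n.+1 / n.+1`!%:R <= expR (s * y).
  by apply: le_trans h; rewrite lerDr.
rewrite expRN ler_pdivrMr ?expR_gt0// mulrAC ler_pdivlMr ?exprn_gt0//.
rewrite mulrC in h; by rewrite -exprMn (mulrC y) -ler_pdivrMl// ltr0n fact_gt0.
Qed.

(** Exponential decay beats polynomial growth. *)
Lemma poly_expR_bounded (s : R) P (n : nat) : 0 < s ->
  exists C, forall y : R, 0 < y -> `|P.[y]| * y ^+ n.+1 * expR (- (s * y)) <= C.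
Proof.
move=> s0; elim/poly_ind: P n => [|P c IH] n.
  by exists 0 => y y0; rewrite horner0 normr0 !mul0r.
have [C1 h1] := IH n.+1; have [C2 h2] := pow_expR_bounded n s0.
exists (C1 + `|c| * C2) => y y0.
rewrite hornerMXaddC.
apply: (@le_trans _ _ ((`|P.[y]| * y + `|c|) * y ^+ n.+1 * expR (- (s * y)))).
  rewrite ler_wpM2r ?expR_ge0// ler_wpM2r ?exprn_ge0 ?(ltW y0)//.
  by rewrite (le_trans (ler_normD _ _))// normrM (gtr0_norm y0).
rewrite !mulrDl lerD//.
  by rewrite -(mulrA `|_|) -exprS h1.
by rewrite -mulrA ler_wpM2l// h2.
Qed.

(** t |-> P(1/t) exp(-s/t) for t > 0, extended by 0.  For s > 0 this family is
    closed under differentiation (flatD gives the new polynomial), which makes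
    its members smooth, also at 0. *)
Definition flat (s : R) P (t : R) : R :=
  if 0 < t then P.[t^-1] * expR (- (s * t^-1)) else 0.

(** The polynomial of the derivative of flat s P. *)
Definition flatD (s : R) P : {poly R} := 'X^2 * (s *: P - P^`()).

Lemma is_derive_horner P (x : R) : is_derive x (1 : R) (horner P) P^`().[x].
Proof.
by split; [exact: derivable_horner|rewrite derivE derive1E].
Qed.

Lemma is_derive_flat (s : R) P (t : R) : 0 < s ->
  is_derive t (1 : R) (flat s P) (flat s (flatD s P) t).
Proof.
move=> s0; case: (ltgtP t 0) => [t0|t0|->].
- rewrite {2}/flat (lt_gtF t0).
  apply: (@near_eq_is_derive _ _ _ (cst 0)) => //.
  near=> u; rewrite /flat ltNge ltW//; near: u.
  exact: lt_nbhsl.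
- rewrite {2}/flat t0.
  apply: (@near_eq_is_derive _ R R (fun u => P.[u^-1] * expR (- (s * u^-1)))).
    near=> u; rewrite /flat ifT//; near: u.
    exact: lt_nbhsr.
  have tn0 : t != 0 by rewrite gt_eqF.
  have dV : is_derive t (1 : R) (fun u : R => u^-1) (- t ^- 2).
    by have := @is_deriveV R id t 1 1 tn0 _; rewrite /GRing.scale/= mulr1; apply.
  have d1 : is_derive t (1 : R) (fun u : R => P.[u^-1]) (P^`().[t^-1] * - t ^- 2).
    by have := is_derive_horner P t^-1 => h; apply: (@is_derive1_comp _ (horner P)).
  have d2 : is_derive t (1 : R) (fun u : R => expR (- (s * u^-1)))
      (expR (- (s * t^-1)) * - (s * - t ^- 2)).
    exact: (@is_derive1_comp _ expR (fun u : R => - (s * u^-1))).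
  apply: is_derive_eq; rewrite /GRing.scale/= /flatD hornerM hornerXn hornerD hornerN hornerZ.
  by rewrite exprVn; ring.
(* at 0 the function is O(u^2), so its difference quotient tends to 0 *)
- rewrite {2}/flat ltxx; apply/is_derive_cvg.
  have [C hC] := poly_expR_bounded P 1 s0.
  have h (u : R) : `|flat s P u| <= `|C| * u ^+ 2.
    rewrite /flat; case: ifPn => u0; last by rewrite normr0 mulr_ge0// sqr_ge0.
    have ui : 0 < u^-1 by rewrite invr_gt0.
    rewrite normrM (ger0_norm (expR_ge0 _)) -ler_pdivrMr ?exprn_gt0//.
    rewrite mulrAC -exprVn; apply: le_trans (hC _ ui) _; exact: ler_norm.
  have n0 : `|u| @[u --> (0 : R)^'] --> (0 : R).
    rewrite -[X in _ --> X](@normr0 _ R); apply: cvg_norm.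
    by move=> A; exact: nbhs_dnbhs.
  have Cn0 : `|C| * `|u| @[u --> (0 : R)^'] --> (0 : R).
    rewrite -[X in _ --> X](mulr0 `|C|); apply: cvgM => //; exact: cvg_cst.
  apply: (@squeeze_cvgr _ _ _ _ (fun u => - (`|C| * `|u|)) (fun u => `|C| * `|u|)).
  + near=> u.
    have u0 : u != 0 by near: u; exact: nbhs_dnbhs_neq.
    rewrite -ler_norml {2}/flat ltxx subr0 addr0 /GRing.scale/= mulr1 normrM normfV.
    by rewrite ler_pdivrMl ?normr_gt0// mulrCA -expr2 real_normK ?num_real.
  + by rewrite -[X in _ --> X]oppr0; apply: cvgN.
  + by [].
Unshelve. all: by end_near. 
Qed.

Lemma flat_smooth (s : R) P : 0 < s -> smooth1 (flat s P).
Proof.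
move=> s0 k; elim: k P => [//|k IH] P.
by exists (flat s (flatD s P)) => // x; exact: is_derive_flat.
Qed.

(** exp(-s/(t-l)) exp(-s/(r-t)) on ]l, r[, and 0 elsewhere; it tends to the
    indicator function of ]l, r[ as s -> 0. *)
Definition cutoff (s l r t : R) : R := flat s 1 (t - l) * flat s 1 (r - t).

Lemma cutoff_smooth (s l r : R) : 0 < s -> smooth1 (cutoff s l r).
Proof.
move=> s0 k; have h := flat_smooth 1 s0 k.
have := DnM (Dn_affine 1 (- l) h) (Dn_affine (- 1) r h).
by congr Dn; apply/funext => t/=; rewrite /cutoff mul1r mulN1r (addrC _ r).
Qed.

Lemma cutoffE (s l r t : R) :
  cutoff s l r t =
  if l < t < r then expR (- (s * (t - l)^-1)) * expR (- (s * (r - t)^-1)) else 0.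
Proof.
rewrite /cutoff /flat !subr_gt0 !hornerC !mul1r.
by case: (l < t) => /=; case: (t < r); rewrite ?mul0r ?mulr0.
Qed.

Lemma cutoff_ge0 (s l r t : R) : 0 <= cutoff s l r t.
Proof. by rewrite cutoffE; case: ifP => // _; rewrite mulr_ge0 ?expR_ge0. Qed.

Lemma cutoff_le1 (s l r t : R) : 0 < s -> cutoff s l r t <= 1.
Proof.
move=> s0; rewrite cutoffE; case: ifP => [/andP[lt tr]|//].
rewrite mulr_ile1 ?expR_ge0// expR_le1 oppr_le0 mulr_ge0 ?(ltW s0)//.
  by rewrite invr_ge0 subr_ge0 ltW.
by rewrite invr_ge0 subr_ge0 ltW.
Qed.

Lemma cutoff_cvg (l r t : R) :
  cutoff n.+1%:R^-1 l r t @[n --> \oo] --> (\1_(`]l, r[%classic) t : R).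
Proof.
rewrite indicE; have -> : (t \in `]l, r[%classic) = (l < t < r).
  by apply/idP/idP; rewrite inE/= in_itv.
under eq_fun do rewrite cutoffE.
case: (l < t < r); last exact: cvg_cst; rewrite /=.
have h (c : R) : expR (- (n.+1%:R^-1 * c)) @[n --> \oo] --> (1 : R).
  rewrite -[X in _ --> X]expR0; apply: continuous_cvg; first exact: continuous_expR.
  rewrite -[X in _ --> X]oppr0; apply: cvgN.
  rewrite -[X in _ --> X](mul0r c); apply: cvgM; last exact: cvg_cst.
  exact: (@cvg_harmonic R).
by have := cvgM (h (t - l)^-1) (h (r - t)^-1); rewrite mulr1; apply.
Qed.

End smooth_functions_of_one_variable.

(** * Almost everywhere, Dynkin induction and sigma-finiteness *)

(** Monotonicity of almost everywhere statements. *)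
Lemma aeS d (T : sigmaRingType d) (R : realFieldType)
    (mu : {measure set T -> \bar R}) (P Q : T -> Prop) :
  (forall x, P x -> Q x) ->
  {ae mu, forall x, P x} -> {ae mu, forall x, Q x}.
Proof. by move=> PQ; apply: negligibleS => x nQ /PQ. Qed.

Lemma aeS2 d (T : sigmaRingType d) (R : realFieldType)
    (mu : {measure set T -> \bar R}) (P Q S : T -> Prop) :
  (forall x, P x -> Q x -> S x) ->
  {ae mu, forall x, P x} -> {ae mu, forall x, Q x} -> {ae mu, forall x, S x}.
Proof.
move=> PQS P1 Q1; have := negligibleU P1 Q1.
apply: negligibleS => x nS; have [Px|] := pselect (P x); last by left.
by right => Qx; apply: nS; exact: PQS.
Qed.

Section integral_zero_induction.
Local Open Scope ereal_scope.
Context d d' (T : measurableType d) (T' : measurableType d') (R : realType).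
Variable mu : {measure set T -> \bar R}.

(** If the integral of f over B and over all B `&` pi^-1(A) with A in a
    generating pi-system vanishes, it vanishes for all measurable A. *)
Lemma integral0_induction (G : set (set T')) (pi : T -> T') (B : set T)
    (f : T -> \bar R) :
  measurable = <<s G >> -> setI_closed G -> measurable_fun setT pi ->
  measurable B -> mu.-integrable B f ->
  \int[mu]_(x in B) f x = 0 ->
  (forall A, G A -> \int[mu]_(x in B `&` pi @^-1` A) f x = 0) ->
  forall A, measurable A -> \int[mu]_(x in B `&` pi @^-1` A) f x = 0.
Proof.
move=> GE GI mpi mB fi fB fG.
suff h A : <<s G >> A -> \int[mu]_(x in B `&` pi @^-1` A) f x = 0.
  by move=> A mA; apply: h; rewrite -GE.
move: A.
have mpre A : measurable A -> measurable (B `&` pi @^-1` A).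
  by move=> mA; apply: measurableI => //; rewrite -(setTI (_ @^-1` _)); exact: mpi.
have iS A : A `<=` B -> measurable A -> mu.-integrable A f.
  by move=> AB mA; apply: integrableS fi.
apply: dynkin_induction => //.
- by rewrite preimage_setT setIT.
- move=> S mS S0.
  have : \int[mu]_(x in (B `&` pi @^-1` S) `|` (B `&` pi @^-1` (~` S))) f x = 0.
    by rewrite preimage_setC -setIUr setUv setIT.
  rewrite integral_setU //=; [|exact: mpre|apply: mpre; exact: measurableC| |].
  + by rewrite S0 add0e.
  + by rewrite preimage_setC -setIUr setUv setIT; exact: measurable_int fi.
  + by apply/disj_setPS => x [[_ h1] [_ h2]]; exact: h2.
- move=> F mF tF F0; rewrite preimage_bigcup setI_bigcupr integral_bigcup//.
  + by rewrite eseries0.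
  + apply/trivIsetP => i j _ _ ij; move/trivIsetP : tF => /(_ i j I I ij).
    move=> FF; rewrite -subset0 => x [[_ h1] [_ h2]].
    by have : (F i `&` F j) (pi x) by []; rewrite FF.
  + by move=> k; exact: mpre.
  + apply: iS; first by move=> x [n _ []].
    by apply: bigcupT_measurable => k; exact: mpre.
Qed.

End integral_zero_induction.

Lemma product_sigma_finite d1 d2 (T1 : measurableType d1)
    (T2 : measurableType d2) (R : realType)
    (m1 : {sigma_finite_measure set T1 -> \bar R})
    (m2 : {sigma_finite_measure set T2 -> \bar R}) :
  sigma_finite setT (m1 \x m2)%E.
Proof.
have [F TF Foo] := sigma_finiteT m1; have [G TG Goo] := sigma_finiteT m2.
pose FG (q : option (nat * nat)) :=
  if q is Some ij then F ij.1 `*` G ij.2 else set0.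
exists (fun n => FG (unpickle n)).
  rewrite -setXTT TF TG; apply/seteqP; split => -[x y].
    move=> [/= [n _ Fnx] [k _ Gky]]; exists (pickle (n, k)) => //.
    by rewrite pickleK.
  by move=> [n _]; case: unpickle => // -[i j] [/= Fx Gy]; split; [exists i|exists j].
move=> n; case: unpickle => [[i j]|] /=; last by rewrite measure0.
have [mF Fi] := Foo i; have [mG Gj] := Goo j.
split; first exact: measurableX.
by rewrite product_measure1E// lte_mul_pinfty// ge0_fin_numE.
Qed.

Section sigma_finite_instances.
Variable R : realType.

Lemma leb2_sigma_finite : sigma_finite setT (leb2 R).
Proof. exact: product_sigma_finite. Qed.

HB.instance Definition _ :=
  Measure_isSigmaFinite.Build _ _ _ (leb2 R) leb2_sigma_finite.

Lemma leb3_sigma_finite : sigma_finite setT (leb3 R).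
Proof. exact: product_sigma_finite. Qed.

HB.instance Definition _ :=
  Measure_isSigmaFinite.Build _ _ _ (leb3 R) leb3_sigma_finite.

End sigma_finite_instances.

(** * Boxes in space; open sets are measurable *)

Lemma open_setX (S T : topologicalType) (A : set S) (B : set T) :
  open A -> open B -> open (A `*` B).
Proof.
rewrite !openE => oA oB [x y] [/= Ax By]; exists (A, B) => //=.
by split; [exact: oA|exact: oB].
Qed.

Section boxes.
Variable R : realType.
Implicit Types (l r x : space R) (Om : set (space R)).

(** The open box with corners l and r. *)
Definition obox l r : set (space R) :=
  (`]l.1.1, r.1.1[ `*` `]l.1.2, r.1.2[) `*` `]l.2, r.2[.

(** The closed box with corners l and r; empty if some l_i > r_i. *)
Definition cbox l r : set (space R) :=
  (`[l.1.1, r.1.1] `*` `[l.1.2, r.1.2]) `*` `[l.2, r.2].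

Lemma obox_sub l r : obox l r `<=` cbox l r.
Proof.
by move=> x [[h1 h2] h3]; split; [split|]; exact: subset_itv_oo_cc.
Qed.

Lemma open_box Om x : open Om -> Om x -> exists q : rat * rat * rat * (rat * rat * rat),
  let l := (ratr q.1.1.1, ratr q.1.1.2, ratr q.1.2) in
  let r := (ratr q.2.1.1, ratr q.2.1.2, ratr q.2.2) in
  obox l r x /\ cbox l r `<=` Om.
Proof.
move=> oOm Omx; have /nbhs_ballP[e /= e0 eOm] : nbhs x Om by exact: open_nbhs_nbhs.
have lt1 (t : R) : exists q : rat, t - e < ratr q < t.
  have [|q] := @rat_in_itvoo R (t - e) t; first by rewrite ltrBlDr ltrDl.
  by rewrite in_itv/=; exists q.
have lt2 (t : R) : exists q : rat, t < ratr q < t + e.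
  have [|q] := @rat_in_itvoo R t (t + e); first by rewrite ltrDl.
  by rewrite in_itv/=; exists q.
have [l1 /andP[a1 b1]] := lt1 x.1.1; have [l2 /andP[a2 b2]] := lt1 x.1.2.
have [l3 /andP[a3 b3]] := lt1 x.2.
have [r1 /andP[c1 d1]] := lt2 x.1.1; have [r2 /andP[c2 d2]] := lt2 x.1.2.
have [r3 /andP[c3 d3]] := lt2 x.2.
exists ((l1, l2, l3), (r1, r2, r3)); split => /=.
  by split; [split|]; rewrite /= in_itv/= ?b1 ?b2 ?b3.
move=> y [[]]; rewrite /= !in_itv/= => /andP[h1 h1'] /andP[h2 h2'] /andP[h3 h3'].
apply: eOm; split; [split|]; rewrite /= -ball_normE/= ltr_distlC.
- by rewrite (lt_le_trans a1)// (le_lt_trans h1').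
- by rewrite (lt_le_trans a2)// (le_lt_trans h2').
- by rewrite (lt_le_trans a3)// (le_lt_trans h3').
Qed.

(** An open set is a countable union of open boxes, and even the corresponding
    closed boxes are contained in it. *)
Lemma open_box_cover Om : open Om -> exists l r : nat -> space R,
  (forall n, cbox (l n) (r n) `<=` Om) /\ Om = \bigcup_n obox (l n) (r n).
Proof.
move=> oOm.
pose L (q : rat * rat * rat * (rat * rat * rat)) : space R :=
  (ratr q.1.1.1, ratr q.1.1.2, ratr q.1.2).
pose U (q : rat * rat * rat * (rat * rat * rat)) : space R :=
  (ratr q.2.1.1, ratr q.2.1.2, ratr q.2.2).
pose ok n q := unpickle n = Some q /\ cbox (L q) (U q) `<=` Om.
have /choice[lr lrP] n : exists lr : space R * space R,
    cbox lr.1 lr.2 `<=` Om /\ (forall q, ok n q -> lr = (L q, U q)).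
  have [[q [uq Oq]]|nq] := pselect (exists q, ok n q).
    exists (L q, U q); split => // q' [uq' _].
    by move: uq'; rewrite uq => -[->].
  (* indices that do not code an admissible box get an empty box *)
  exists ((1, 1, 1), (0, 0, 0)); split.
    by move=> x [_]; rewrite /= in_itv/= => /andP[h /(le_trans h)]; rewrite ler10.
  by move=> q okq; exfalso; apply: nq; exists q.
exists (fun n => (lr n).1), (fun n => (lr n).2); split => [n|].
  by have [] := lrP n.
apply/seteqP; split => [x Omx|x [n _]].
  have [q [qx qOm]] := open_box oOm Omx.
  exists (pickle q) => //; have [_ /(_ q)] := lrP (pickle q).
  by rewrite /ok pickleK => -> //.
by move=> /obox_sub; have [+ _] := lrP n; apply.
Qed.

Lemma measurable_obox l r : measurable (obox l r : set (mspace R)).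
Proof. by apply: measurableX; [apply: measurableX|]; exact: measurable_itv. Qed.

Lemma open_measurable3 Om : open Om -> measurable (Om : set (mspace R)).
Proof.
move=> /open_box_cover[l [r [_ ->]]].
by apply: bigcupT_measurable => n; exact: measurable_obox.
Qed.

Lemma open_measurable2 (om : set (plane R)) : open om -> measurable (om : set (mplane R)).
Proof.
move=> oom; have -> : om = ysection (om `*` [set: measurableTypeR R]) (0 : R).
  apply/seteqP; split => x; rewrite /ysection/= inE/=; first by [].
  by case.
by apply: measurable_ysection; apply: open_measurable3; apply: open_setX => //; exact: openT.
Qed.

End boxes.

(** * The fundamental lemma of the calculus of variations *)

Section vanishing_on_a_box.
Local Open Scope ereal_scope.
Variable R : realType.
Implicit Types (l r x : space R).

(** The half-line ]a, +oo[, or the whole line. *)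
Definition ray (o : option R) : set (measurableTypeR R) :=
  if o is Some a then `]a, +oo[%classic else setT.

Lemma measurable_ray o : measurable (ray o).
Proof. by case: o => [a|] /=; [exact: measurable_itv|exact: measurableT]. Qed.

(** The lower end of ]a, b[ intersected with ray o. *)
Definition raybound (o : option R) (a : R) : R :=
  if o is Some b then Num.max b a else a.

Lemma ray_itv o (a b x : R) :
  ((a < x < b)%R /\ ray o x) = (raybound o a < x < b)%R :> Prop.
Proof.
apply/propext; case: o => [c|] /=; last by split=> [[]|].
rewrite in_itv/= andbT gt_max; split.
  by move=> [/andP[-> ->] ->].
by move=> /andP[/andP[-> ->] ->].
Qed.

Lemma RGenOInfty_setI : setI_closed (@RGenOInfty.G R).
Proof.
move=> _ _ [a ->] [b ->]; exists (Num.max a b).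
apply/seteqP; split => x /=; rewrite !in_itv/= !andbT gt_max.
  by move=> [-> ->].
by move=> /andP[].
Qed.

(** A function integrable on an open box is zero almost everywhere if its
    integral over every sub-box with the same upper corner vanishes: products
    of half-lines generate the sigma-algebra. *)
Lemma box_ae_eq0 l r (f : space R -> R) :
  (leb3 R).-integrable (obox l r) (EFin \o f) ->
  (forall l', cbox l' r `<=` cbox l r ->
    \int[leb3 R]_(x in obox l' r) (f x)%:E = 0) ->
  {ae leb3 R, forall x, obox l r x -> f x = 0%R}.
Proof.
move=> fi fbox; pose Q := obox l r.
pose Z (A : set (space R)) := \int[leb3 R]_(x in Q `&` A) (f x)%:E = 0.
have mQ : measurable (Q : set (mspace R)) by exact: measurable_obox.
have mf1 : measurable_fun setT (fun x : mspace R => x.1.1).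
  by apply: (measurableT_comp measurable_fst); exact: measurable_fst.
have mf2 : measurable_fun setT (fun x : mspace R => x.1.2).
  by apply: (measurableT_comp measurable_snd); exact: measurable_fst.
have mf3 : measurable_fun setT (fun x : mspace R => x.2).
  exact: measurable_snd.
have ind d' (T' : measurableType d') (G : set (set T'))
    (pi : mspace R -> T')
    (A : set (mspace R)) :
    measurable = <<s G >> -> setI_closed G -> measurable_fun setT pi ->
    measurable A -> Z A -> (forall C, G C -> Z (A `&` pi @^-1` C)) ->
    forall C, measurable C -> Z (A `&` pi @^-1` C).
  move=> GE GI mpi mA ZA ZG C mC; rewrite /Z setIA.
  apply: (@integral0_induction _ _ _ _ _ (leb3 R) G pi) => //.
  - exact: measurableI.
  - apply: integrableS fi => //; exact: measurableI.
  - by move=> D GD; rewrite -setIA; exact: ZG.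
have GE : measurable = <<s @RGenOInfty.G R >> :> set (set (measurableTypeR R)).
  exact: RGenOInfty.measurableE.
(* products of half-lines, then of measurable sets, one factor at a time *)
have c0 o1 o2 o3 : Z ((ray o1 `*` ray o2) `*` ray o3).
  pose l' := (raybound o1 l.1.1, raybound o2 l.1.2, raybound o3 l.2).
  have -> : Z ((ray o1 `*` ray o2) `*` ray o3) =
      (\int[leb3 R]_(x in obox l' r) (f x)%:E = 0).
    rewrite /Z; congr (integral _ _ _ = 0).
    apply/seteqP; split => x; rewrite /Q /obox /setX/setI/= !in_itv/=.
      by move=> [[[h1 h2] h3] [[k1 k2] k3]]; rewrite -!ray_itv.
    by rewrite -!ray_itv => -[[[h1 k1] [h2 k2]] [h3 k3]].
  apply: fbox => x; rewrite /cbox /setX/= !in_itv/= => -[[/andP[h1 ->] /andP[h2 ->]] /andP[h3 ->]].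
  have rb o (a b : R) : (raybound o a <= b -> a <= b)%R.
    by case: o => //= c; rewrite ge_max => /andP[].
  by rewrite !andbT; split; [split; [exact: rb h1|exact: rb h2]|exact: rb h3].
have mX (A1 A2 A3 : set (measurableTypeR R)) :
    measurable A1 -> measurable A2 -> measurable A3 -> measurable ((A1 `*` A2) `*` A3).
  by move=> m1 m2 m3; apply: measurableX => //; exact: measurableX.
have mr := measurable_ray.
have c1 o1 o2 A3 : measurable A3 -> Z ((ray o1 `*` ray o2) `*` A3).
  move=> mA3; have -> : (ray o1 `*` ray o2) `*` A3 =
      ((ray o1 `*` ray o2) `*` ray None) `&` (fun x => x.2) @^-1` A3.
    by apply/seteqP; split => x; rewrite /setT/setX/setI/preimage/=; tauto.
  apply: (ind _ _ _ _ _ GE RGenOInfty_setI) => //; first exact: mX.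
  move=> _ [a ->]; suff -> : ray o1 `*` ray o2 `*` ray None `&` (fun x => x.2) @^-1` `]a, +oo[ =
      (ray o1 `*` ray o2) `*` ray (Some a) by exact: c0.
  by apply/seteqP; split => x; rewrite /setT/setX/setI/preimage/=; tauto.
have c2 o1 A2 A3 : measurable A2 -> measurable A3 -> Z ((ray o1 `*` A2) `*` A3).
  move=> mA2 mA3; have -> : (ray o1 `*` A2) `*` A3 =
      ((ray o1 `*` ray None) `*` A3) `&` (fun x => x.1.2) @^-1` A2.
    by apply/seteqP; split => x; rewrite /setT/setX/setI/preimage/=; tauto.
  apply: (ind _ _ _ _ _ GE RGenOInfty_setI) => //; [exact: mX|exact: (c1 o1 None)|].
  move=> _ [a ->]; suff -> : ray o1 `*` ray None `*` A3 `&` (fun x => x.1.2) @^-1` `]a, +oo[ =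
      (ray o1 `*` ray (Some a)) `*` A3 by exact: c1.
  by apply/seteqP; split => x; rewrite /setT/setX/setI/preimage/=; tauto.
have c3 A1 A2 A3 : measurable A1 -> measurable A2 -> measurable A3 ->
    Z ((A1 `*` A2) `*` A3).
  move=> mA1 mA2 mA3; have -> : (A1 `*` A2) `*` A3 =
      ((ray None `*` A2) `*` A3) `&` (fun x => x.1.1) @^-1` A1.
    by apply/seteqP; split => x; rewrite /setT/setX/setI/preimage/=; tauto.
  apply: (ind _ _ _ _ _ GE RGenOInfty_setI) => //; [exact: mX|exact: (c2 None)|].
  move=> _ [a ->]; suff -> : ray None `*` A2 `*` A3 `&` (fun x => x.1.1) @^-1` `]a, +oo[ =
      (ray (Some a) `*` A2) `*` A3 by exact: c2.
  by apply/seteqP; split => x; rewrite /setT/setX/setI/preimage/=; tauto.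
have rectI d1 d2 (T1 : measurableType d1) (T2 : measurableType d2) :
    setI_closed [set A `*` B | A in @measurable _ T1 & B in @measurable _ T2].
  move=> _ _ [A1 mA1 [A2 mA2 <-]] [B1 mB1 [B2 mB2 <-]].
  exists (A1 `&` B1); first exact: measurableI.
  by exists (A2 `&` B2); [exact: measurableI|rewrite setXI].
have c4 A A3 : measurable A -> measurable A3 -> Z (A `*` A3).
  move=> mA mA3; have -> : A `*` A3 = ((setT `*` setT) `*` A3) `&` fst @^-1` A.
    by apply/seteqP; split => x; rewrite /setT/setX/setI/preimage/=; tauto.
  apply: (ind _ _ _ _ _ (measurable_prod_measurableType _ _) (rectI _ _ _ _)) => //.
  - exact: mX.
  - exact: c3.
  move=> _ [A1 mA1 [A2 mA2 <-]].
  suff -> : setT `*` setT `*` A3 `&` fst @^-1` (A1 `*` A2) =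
      (A1 `*` A2) `*` A3 by exact: c3.
  by apply/seteqP; split => x; rewrite /setT/setX/setI/preimage/=; tauto.
have c5 A : measurable A -> Z A.
  move=> mA; rewrite -(setTI A); have -> : A = id @^-1` A by [].
  apply: (ind _ _ _ _ _ (measurable_prod_measurableType _ _) (rectI _ _ _ _)) => //.
  - by rewrite -setXTT; exact: c4.
  by move=> _ [A1 mA1 [A2 mA2 <-]]; rewrite setTI; exact: c4.
have : ae_eq (leb3 R) Q (EFin \o f) (cst 0).
  apply: integral_ae_eq => //.
  move=> E EQ mE; rewrite integral0; have := c5 _ mE.
  by rewrite /Z setIidr.
by apply: filterS => x h /h /= [].
Qed.

End vanishing_on_a_box.

Section fundamental_lemma.
Variable R : realType.
Implicit Types (l r x : space R) (Om : set (space R)) (f : space R -> R).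

(** The product of the one-dimensional cut-off functions of the sides of the
    box with corners l and r. *)
Definition cutoff3 (s : R) l r x : R :=
  cutoff s l.1.1 r.1.1 x.1.1 * cutoff s l.1.2 r.1.2 x.1.2 * cutoff s l.2 r.2 x.2.

Lemma measurable_cutoff (s l r : R) : 0 < s ->
  measurable_fun [set: measurableTypeR R] (cutoff s l r).
Proof.
by move=> s0; apply: continuous_measurable_fun; apply: smooth1_continuous; exact: cutoff_smooth.
Qed.

Lemma measurable_cutoff3 (s : R) l r : 0 < s ->
  measurable_fun [set: mspace R]
    (cutoff3 s l r).
Proof.
move=> s0; apply: measurable_funM; first apply: measurable_funM.
- apply: (measurableT_comp (measurable_cutoff _ _ s0)).
  by apply: (measurableT_comp measurable_fst); exact: measurable_fst.
- apply: (measurableT_comp (measurable_cutoff _ _ s0)).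
  by apply: (measurableT_comp measurable_snd); exact: measurable_fst.
- by apply: (measurableT_comp (measurable_cutoff _ _ s0)); exact: measurable_snd.
Qed.

Lemma cutoff3_out (s : R) l r x : ~ obox l r x -> cutoff3 s l r x = 0.
Proof.
move=> nx; rewrite /cutoff3 !cutoffE; case: ifPn => h1; last by rewrite !mul0r.
case: ifPn => h2; last by rewrite mulr0 mul0r.
case: ifPn => h3; last by rewrite mulr0.
by case: nx; rewrite /obox /setX/= !in_itv.
Qed.

Lemma cutoff3_ge0 (s : R) l r x : 0 <= cutoff3 s l r x.
Proof.
by apply: mulr_ge0; [apply: mulr_ge0|]; exact: cutoff_ge0.
Qed.

Lemma cutoff3_le1 (s : R) l r x : 0 < s -> cutoff3 s l r x <= 1.
Proof.
move=> s0; apply: mulr_ile1; rewrite ?cutoff_ge0 ?cutoff_le1//.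
  by rewrite mulr_ge0 ?cutoff_ge0.
by apply: mulr_ile1; rewrite ?cutoff_ge0 ?cutoff_le1.
Qed.

Lemma cutoff3_cvg l r x : obox l r x ->
  cutoff3 n.+1%:R^-1 l r x @[n --> \oo] --> (1 : R).
Proof.
move=> [[h1 h2] h3]; have h := cvgM (cvgM (@cutoff_cvg R l.1.1 r.1.1 x.1.1)
  (@cutoff_cvg R l.1.2 r.1.2 x.1.2)) (@cutoff_cvg R l.2 r.2 x.2).
by move: h; rewrite !indicE !mem_set// !mulr1; apply.
Qed.

(** The fundamental lemma: testing against products of cut-off functions is
    enough, since these tend boundedly to the indicator of the box. *)
Lemma cutoff_integrals_eq0 Om f :
  open Om -> measurable_fun Om f ->
  (forall l r, cbox l r `<=` Om ->
     (leb3 R).-integrable (obox l r) (EFin \o f)) ->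
  (forall l r (s : R), cbox l r `<=` Om -> obox l r !=set0 -> 0 < s ->
     \int[leb3 R]_(x in Om) (f x * cutoff3 s l r x) = 0) ->
  {ae leb3 R, forall x, Om x -> f x = 0}.
Proof.
move=> oOm mf fi f0.
have fbox l r : cbox l r `<=` Om -> (\int[leb3 R]_(x in obox l r) (f x)%:E = 0)%E.
  move=> lrOm; have [->|lr0] := eqVneq (obox l r) set0; first exact: integral_set0.
  have oOm' : obox l r `<=` Om by move=> x /obox_sub/lrOm.
  have mQ := @measurable_obox R l r.
  have mfQ : measurable_fun (obox l r) f.
    by apply: measurable_funS mf => //; exact: open_measurable3.
  pose u (n : nat) x := (f x * cutoff3 n.+1%:R^-1 l r x)%:E.
  have mu n : measurable_fun (obox l r) (u n).
    apply/measurable_EFinP; apply: measurable_funM => //.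
    apply: measurable_funTS; exact: measurable_cutoff3.
  have ub n x : (`|u n x| <= (`|f x|)%:E)%E.
    rewrite lee_fin normrM -[leRHS]mulr1 ler_wpM2l//.
    by rewrite ger0_norm ?cutoff3_ge0// cutoff3_le1.
  have fiabs := integrable_norm (fi _ _ lrOm).
  have mfE : measurable_fun (obox l r) (EFin \o f) by exact/measurable_EFinP.
  have ucvg : {ae leb3 R, forall x, obox l r x -> u n x @[n --> \oo] --> (f x)%:E}.
    apply: nearW => x Qx; apply: cvg_EFin; first exact: nearW.
    have := cvgM (cvg_cst (f x)) (cutoff3_cvg Qx); rewrite mulr1.
    exact.
  have udom : {ae leb3 R, forall x n, obox l r x -> (`|u n x| <= (`|f x|)%:E)%E}.
    by apply: nearW => x n _; exact: ub.
  have [_ _ ] := dominated_convergence mQ mu mfE ucvg fiabs udom.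
  have -> : (fun n => \int[leb3 R]_(x in obox l r) u n x)%E = cst 0%E.
    apply/funext => n.
    have ui : (leb3 R).-integrable (obox l r) (u n).
      apply: (le_integrable mQ (mu n) _ fiabs) => x Qx.
      by apply: le_trans (ub n x) _; rewrite /= lee_fin normr_id.
    have E : (\int[leb3 R]_(x in obox l r) u n x = \int[leb3 R]_(x in Om) u n x)%E.
      rewrite integral_mkcond [RHS]integral_mkcond; apply: eq_integral => x _.
      rewrite !patchE; have [xQ|xQ] := pselect (obox l r x).
        by rewrite !mem_set//; exact: oOm'.
      rewrite (memNset xQ); case: ifPn => // _.
      by rewrite /u cutoff3_out// mulr0.
    rewrite -[LHS]fineK ?integrable_fin_num// E.
    have := f0 l r n.+1%:R^-1 lrOm; rewrite /Rintegral => ->//.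
    exact/set0P.
  by move=> h; apply/esym; apply: (cvg_unique _ _ h) => //; exact: cvg_cst.
have [l [r [lrOm OmE]]] := open_box_cover oOm.
have ae0 n : {ae leb3 R, forall x, obox (l n) (r n) x -> f x = 0}.
  apply: box_ae_eq0; first exact: fi.
  by move=> l' l'l; apply: fbox => x /l'l; exact: lrOm.
have : {ae leb3 R, forall x n, obox (l n) (r n) x -> f x = 0}.
  apply/ae_foralln => n; exact: ae0.
by apply: aeS => x fx; rewrite {1}OmE => -[n _]; exact: fx.
Qed.

End fundamental_lemma.

(** * Tensor products of test functions *)

Section tensor_products.
Variable R : realType.

Lemma is_derive_tensor_fst (V : normedModType R) (g : V -> R) (c : R -> R)
    (x : V * R) (v : V) (d : R) :
  is_derive x.1 v g d ->
  is_derive x ((v, 0) : V * R) (fun y : V * R => g y.1 * c y.2) (d * c x.2).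
Proof.
move=> /is_derive_cvg h; apply/is_derive_cvg.
rewrite [X in X @ _](_ : _ = fun t => t^-1 *: (g (t *: v + x.1) - g x.1) * c x.2).
  by apply: cvgM => //; exact: cvg_cst.
by apply/funext => t /=; rewrite scaler0 add0r -mulrBl /GRing.scale/= mulrA.
Qed.

Lemma is_derive_tensor_snd (V : normedModType R) (g : V -> R) (c : R -> R)
    (x : V * R) (d : R) :
  is_derive x.2 (1 : R) c d ->
  is_derive x ((0, 1) : V * R) (fun y : V * R => g y.1 * c y.2) (g x.1 * d).
Proof.
move=> /is_derive_cvg h; apply/is_derive_cvg.
rewrite [X in X @ _](_ : _ = fun t => g x.1 * (t^-1 *: (c (t *: (1 : R) + x.2) - c x.2))).
  by apply: cvgM => //; exact: cvg_cst.
by apply/funext => t /=; rewrite scaler0 add0r -mulrBr /GRing.scale/= mulrCA.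
Qed.

Lemma derivable_is_derive (V W : normedModType R) (f : V -> W) x v :
  derivable f x v -> is_derive x v f ('D_v f x).
Proof. by move=> h; split. Qed.

Section Ck.
Variables (V : normedModType R) (n : nat) (e : 'I_n -> V).

Lemma Ck_continuous k (f : V -> R) : Ck e k f -> continuous f.
Proof. by case: k => [|k] //= []. Qed.

Lemma Ck_derive i (f : V -> R) :
  (forall k, Ck e k f) -> forall k, Ck e k ('D_(e i) f).
Proof. by move=> cf k; have [_ /(_ i)[]] := cf k.+1. Qed.

Lemma Ck_derivable i (f : V -> R) x :
  (forall k, Ck e k f) -> derivable f x (e i).
Proof. by move=> /(_ 1%N)[_ /(_ i)[]]. Qed.

Lemma test_function_derive (Om : set V) (f : V -> R) i :
  test_function e Om f -> test_function e Om ('D_(e i) f).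
Proof.
move=> [cf [K [Kc KOm fK]]]; split; first exact: Ck_derive.
exists K; split => // x nKx.
have oK : open (~` K) by apply: closed_openC; exact: compact_closed.
rewrite (@near_eq_derive _ _ _ f (cst 0)); first exact: derive_cst.
have : \forall y \near x, ~ K y by exact: open_nbhs_nbhs.
by apply: filterS => y; exact: fK.
Qed.

End Ck.

Lemma continuous_tensor (V : normedModType R) (g : V -> R) (c : R -> R) :
  continuous g -> continuous c -> continuous (fun y : V * R => g y.1 * c y.2).
Proof.
move=> cg cc x; apply: (@continuousM _ _ (fun y : V * R => g y.1) (fun y => c y.2)).
  by apply: continuous_comp; [exact: cvg_fst|exact: cg].
by apply: continuous_comp; [exact: cvg_snd|exact: cc].
Qed.

Lemma Ck_tensor2 k (a b : R -> R) : smooth1 a -> smooth1 b ->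
  Ck (@e2 R) k (fun y => a y.1 * b y.2).
Proof.
elim: k a b => [|k IH] a b sa sb.
  by apply: continuous_tensor; exact: smooth1_continuous.
split; first by apply: continuous_tensor; exact: smooth1_continuous.
have D0 x : is_derive x (@e2 R ord0) (fun y => a y.1 * b y.2) ('D_1 a x.1 * b x.2).
  by apply: is_derive_tensor_fst; apply: derivable_is_derive; exact: smooth1_derivable.
have D1 x : is_derive x (@e2 R ord_max) (fun y => a y.1 * b y.2) (a x.1 * 'D_1 b x.2).
  by apply: is_derive_tensor_snd; apply: derivable_is_derive; exact: smooth1_derivable.
move=> i; have [->|->] : i = ord0 \/ i = ord_max.
  by case: i => -[|[|//]] ?; [left|right]; exact: val_inj.
- split; first by move=> x; have [] := D0 x.
  rewrite (_ : 'D_(_) _ = (fun y => 'D_1 a y.1 * b y.2)).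
    by apply: (IH ('D_1 a) b) => //; exact: smooth1_derive.
  by apply/funext => x; have [_ ->] := D0 x.
- split; first by move=> x; have [] := D1 x.
  rewrite (_ : 'D_(_) _ = (fun y => a y.1 * 'D_1 b y.2)).
    by apply: (IH a ('D_1 b)) => //; exact: smooth1_derive.
  by apply/funext => x; have [_ ->] := D1 x.
Qed.

Section tensor3.
Variables (A : plane R -> R) (c : R -> R).
Hypotheses (sA : forall k, Ck (@e2 R) k A) (sc : smooth1 c).

Lemma is_derive_tensor3_k1 (x : space R) :
  is_derive x (@e3 R k1) (fun y => A y.1 * c y.2) ('D_(e2 R ord0) A x.1 * c x.2).
Proof.
apply: (@is_derive_tensor_fst _ _ _ _ (e2 R ord0)).
by apply: derivable_is_derive; exact: Ck_derivable.
Qed.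

Lemma is_derive_tensor3_k2 (x : space R) :
  is_derive x (@e3 R k2) (fun y => A y.1 * c y.2) ('D_(e2 R ord_max) A x.1 * c x.2).
Proof.
apply: (@is_derive_tensor_fst _ _ _ _ (e2 R ord_max)).
by apply: derivable_is_derive; exact: Ck_derivable.
Qed.

Lemma is_derive_tensor3_k3 (x : space R) :
  is_derive x (@e3 R k3) (fun y => A y.1 * c y.2) (A x.1 * 'D_1 c x.2).
Proof.
by apply: is_derive_tensor_snd; apply: derivable_is_derive; exact: smooth1_derivable.
Qed.

End tensor3.

Lemma ord3_cases (i : 'I_3) : [\/ i = k1, i = k2 | i = k3].
Proof.
by case: i => -[|[|[|//]]] ?; [apply: Or31|apply: Or32|apply: Or33]; exact: val_inj.
Qed.

Lemma ord2_cases (i : 'I_2) : i = ord0 \/ i = ord_max.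
Proof. by case: i => -[|[|//]] ?; [left|right]; exact: val_inj. Qed.

Lemma Ck_tensor3 k (A : plane R -> R) (c : R -> R) :
  (forall k, Ck (@e2 R) k A) -> smooth1 c ->
  Ck (@e3 R) k (fun y => A y.1 * c y.2).
Proof.
elim: k A c => [|k IH] A c sA sc.
  by apply: continuous_tensor; [exact: Ck_continuous (sA 0%N)|exact: smooth1_continuous].
split.
  by apply: continuous_tensor; [exact: Ck_continuous (sA 0%N)|exact: smooth1_continuous].
move=> i; case: (ord3_cases i) => ->; split.
- by move=> x; have [] := is_derive_tensor3_k1 c sA x.
- rewrite (_ : 'D_(_) _ = (fun y => 'D_(e2 R ord0) A y.1 * c y.2)).
    by apply: (IH ('D_(e2 R ord0) A) c) => //; exact: Ck_derive.
  by apply/funext => x; have [_ ->] := is_derive_tensor3_k1 c sA x.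
- by move=> x; have [] := is_derive_tensor3_k2 c sA x.
- rewrite (_ : 'D_(_) _ = (fun y => 'D_(e2 R ord_max) A y.1 * c y.2)).
    by apply: (IH ('D_(e2 R ord_max) A) c) => //; exact: Ck_derive.
  by apply/funext => x; have [_ ->] := is_derive_tensor3_k2 c sA x.
- by move=> x; have [] := is_derive_tensor3_k3 A sc x.
- rewrite (_ : 'D_(_) _ = (fun y => A y.1 * 'D_1 c y.2)).
    by apply: (IH A ('D_1 c)) => //; exact: smooth1_derive.
  by apply/funext => x; have [_ ->] := is_derive_tensor3_k3 A sc x.
Qed.

(** Test functions on J: smooth, and zero outside a non-empty segment
    contained in J. *)
Definition test1 (J : set R) (c : R -> R) : Prop :=
  smooth1 c /\
  exists l r : R, [/\ l <= r, `[l, r] `<=` J & forall t, ~ (l <= t <= r) -> c t = 0].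

Lemma test3_tensor (om : set (plane R)) (J : set R) A c :
  test2 om A -> test1 J c -> test3 (om `*` J) (fun y => A y.1 * c y.2).
Proof.
move=> [sA [K [Kc KOm AK]]] [sc [l [r [_ lrJ clr]]]].
split; first by move=> k; exact: Ck_tensor3.
exists (K `*` `[l, r]); split.
- by apply: compact_setX => //; exact: segment_compact.
- by move=> x [Kx lrx]; split; [exact: KOm|exact: lrJ].
- move=> x nx; have [Kx|nKx] := pselect (K x.1); last by rewrite AK// mul0r.
  rewrite clr ?mulr0// => h; apply: nx; split => //=; by rewrite in_itv.
Qed.

Lemma test2_tensor (om : set (plane R)) (a b : R -> R) (l1 r1 l2 r2 : R) :
  smooth1 a -> smooth1 b -> `[l1, r1] `*` `[l2, r2] `<=` om ->
  (forall t, ~ (l1 <= t <= r1) -> a t = 0) ->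
  (forall t, ~ (l2 <= t <= r2) -> b t = 0) ->
  test2 om (fun y => a y.1 * b y.2).
Proof.
move=> sa sb lr a0 b0; split; first by move=> k; exact: Ck_tensor2.
exists (`[l1, r1] `*` `[l2, r2]); split => //.
- by apply: compact_setX => //; exact: segment_compact.
- move=> x nx; have [x1|nx1] := pselect (l1 <= x.1 <= r1); last by rewrite a0// mul0r.
  rewrite b0 ?mulr0// => x2; apply: nx; split => /=; by rewrite in_itv.
Qed.

End tensor_products.

(** * Slices of test functions; continuous functions are measurable *)

Section slices.
Variable R : realType.
Implicit Types (psi : space R -> R).

(** The direction of space R that corresponds to the direction i of the plane. *)
Definition hor (i : 'I_2) : 'I_3 := if i == ord0 then k1 else k2.

Lemma derive_slice (i : 'I_2) psi (y : plane R) (t : R) :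
  (derivable psi (y, t) (@e3 R (hor i)) ->
     derivable (fun y => psi (y, t)) y (@e2 R i)) /\
  'D_(@e2 R i) (fun y => psi (y, t)) y = 'D_(@e3 R (hor i)) psi (y, t).
Proof.
have E : (fun h => h^-1 *: (((fun y => psi (y, t)) \o shift y) (h *: @e2 R i) - psi (y, t))) =
   (fun h => h^-1 *: ((psi \o shift (y, t)) (h *: @e3 R (hor i)) - psi (y, t))) :> (R -> R).
  apply/funext => h; rewrite /=; congr (_ *: (psi _ - _)).
  by rewrite /hor; case: (ord2_cases i) => ->; congr pair => /=; rewrite scaler0 add0r.
by split; rewrite /derivable /derive E.
Qed.

Lemma Ck_slice k psi t : Ck (@e3 R) k psi -> Ck (@e2 R) k (fun y => psi (y, t)).
Proof.
have cs f : continuous f -> continuous (fun y : plane R => (f (y, t) : R)).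
  move=> cf y; apply: (@continuous_comp _ _ _ (fun y => (y, t)) f); last exact: cf.
  apply: (@cvg_pair _ _ _ (nbhs y) (nbhs y) (nbhs t)); last exact: cvg_cst.
  exact: cvg_id.
elim: k psi => [|k IH] psi /=; first exact: cs.
move=> [cpsi dpsi]; split; first exact: cs.
move=> i; have [d1 d2] := dpsi (hor i); split.
  by move=> y; have [+ _] := derive_slice i psi y t; apply; exact: d1.
rewrite (_ : 'D_(_) _ = fun y => 'D_(@e3 R (hor i)) psi (y, t)).
  exact: (IH ('D_(@e3 R (hor i)) psi)).
by apply/funext => y; have [_ ->] := derive_slice i psi y t.
Qed.

Lemma test2_slice (om : set (plane R)) (J : set R) psi t :
  test3 (om `*` J) psi -> test2 om (fun y => psi (y, t)).
Proof.
move=> [cpsi [K [Kc KOm psi0]]]; split; first by move=> k; exact: Ck_slice.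
exists (fst @` K); split.
- apply: continuous_compact => //; apply: continuous_subspaceT => x; exact: cvg_fst.
- by move=> _ [x Kx <-]; have [] := KOm _ Kx.
- by move=> y ny; apply: psi0 => Ky; apply: ny; exists (y, t).
Qed.

Lemma is_derive_slice_snd psi (y : plane R) (t : R) :
  derivable psi (y, t) (@e3 R k3) ->
  is_derive t (1 : R) (fun t => psi (y, t)) ('D_(@e3 R k3) psi (y, t)).
Proof.
move=> /derivable_is_derive/is_derive_cvg h; apply/is_derive_cvg.
rewrite [X in X @ _](_ : _ =
  fun u => u^-1 *: (psi (u *: @e3 R k3 + (y, t)) - psi (y, t)))//.
apply/funext => u /=; congr (_ *: (psi _ - _)).
rewrite [y]surjective_pairing; congr (pair (pair _ _) _) => /=;
  by rewrite scaler0 add0r.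
Qed.

Lemma compact_bounded_cont (V : normedModType R) (f : V -> R) (K : set V) :
  continuous f -> compact K -> (forall x, ~ K x -> f x = 0) ->
  exists M, forall x, `|f x| <= M.
Proof.
move=> cf Kc f0.
have : compact (f @` K) by apply: continuous_compact => //; exact: continuous_subspaceT.
move=> /compact_bounded[M [_ Mf]]; exists (`|M| + 1) => x.
have [Kx|nKx] := pselect (K x); last by rewrite f0// normr0 addr_ge0.
apply: (Mf (`|M| + 1)); last by exists x.
by rewrite (le_lt_trans (ler_norm _))// ltrDl.
Qed.

Lemma test_function_bounded (V : normedModType R) n (e : 'I_n -> V) Om f :
  test_function e Om f -> exists M, forall x, `|f x| <= M.
Proof.
move=> [cf [K [Kc _ f0]]]; apply: (compact_bounded_cont _ Kc f0).
exact: Ck_continuous (cf 0%N).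
Qed.

Lemma test1_bounded J (c : R -> R) : test1 J c -> exists M, forall x, `|c x| <= M.
Proof.
move=> [sc [l [r [_ _ c0]]]].
apply: (compact_bounded_cont (smooth1_continuous sc) (@segment_compact R l r)).
by move=> t; rewrite /= in_itv/=; exact: c0.
Qed.

Lemma measurable_fun_open_preimage d (T : measurableType d) (D : set T) (f : T -> R) :
  measurable D -> (forall U, open U -> measurable (D `&` f @^-1` U)) -> measurable_fun D f.
Proof.
move=> mD fU; apply: (measurability _ (RGenOpens.measurableE R)).
by move=> _ [_ [a [b ->] <-]]; apply: fU; exact: interval_open.
Qed.

Lemma continuous_measurable2 (f : plane R -> R) : continuous f ->
  measurable_fun [set: mplane R] f.
Proof.
move=> /continuousP cf; apply: measurable_fun_open_preimage => // U oU.
by rewrite setTI; apply: open_measurable2; exact: cf.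
Qed.

Lemma continuous_measurable3 (f : space R -> R) : continuous f ->
  measurable_fun [set: mspace R] f.
Proof.
move=> /continuousP cf; apply: measurable_fun_open_preimage => // U oU.
by rewrite setTI; apply: open_measurable3; exact: cf.
Qed.

End slices.

(** * Square integrable functions and Fubini's theorem for real integrals *)

Section L2_functions.
Context d (T : measurableType d) (R : realType).
Variable mu : {measure set T -> \bar R}.
Variables (D : set T) (mD : measurable D).
Implicit Types f g : T -> R.

Lemma L2_sqr_integrable f : L2 mu D f -> mu.-integrable D (EFin \o (fun x => f x ^+ 2)).
Proof.
move=> [mf fi]; apply/integrableP; split.
  by apply/measurable_EFinP; exact: measurable_funX.
rewrite (eq_integral (fun x => (f x ^+ 2)%:E))// => x _ /=.
by rewrite ger0_norm// sqr_ge0.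
Qed.

Lemma L2_mul_integrable f g : L2 mu D f -> L2 mu D g ->
  mu.-integrable D (EFin \o (fun x => f x * g x)).
Proof.
move=> L2f L2g; have [mf _] := L2f; have [mg _] := L2g.
apply: (le_integrable mD _ _
  (integrableD mD (L2_sqr_integrable L2f) (L2_sqr_integrable L2g))).
  by apply/measurable_EFinP; exact: measurable_funM.
move=> x _ /=; rewrite lee_fin [leRHS]ger0_norm ?addr_ge0 ?sqr_ge0//.
rewrite normrM -(real_normK (num_real (f x))) -(real_normK (num_real (g x))).
have := sqr_ge0 (`|f x| - `|g x|); nra.
Qed.

Lemma L2D f g : L2 mu D f -> L2 mu D g -> L2 mu D (fun x => f x + g x).
Proof.
move=> L2f L2g; have [mf _] := L2f; have [mg _] := L2g.
have mfg : measurable_fun D (fun x => f x + g x) by exact: measurable_funD.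
split => //.
have h := integrableZl mD 2 (integrableD mD (L2_sqr_integrable L2f) (L2_sqr_integrable L2g)).
have /integrableP[_] : mu.-integrable D (EFin \o (fun x => (f x + g x) ^+ 2)).
  apply: (le_integrable mD _ _ h).
    by apply/measurable_EFinP; exact: measurable_funX.
  move=> x _ /=; rewrite lee_fin (ger0_norm (sqr_ge0 _)) ger0_norm.
    by have := sqr_ge0 (f x - g x); nra.
  by apply: mulr_ge0 => //; apply: addr_ge0; exact: sqr_ge0.
rewrite (eq_integral (fun x => ((f x + g x) ^+ 2)%:E))// => x _ /=.
by rewrite ger0_norm// sqr_ge0.
Qed.

Lemma L2Z (k : R) f : L2 mu D f -> L2 mu D (fun x => k * f x).
Proof.
move=> L2f; have [mf _] := L2f; split; first exact: measurable_funM.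
have := integrableZl mD (k ^+ 2) (L2_sqr_integrable L2f) => /integrableP[_].
rewrite (eq_integral (fun x => ((k * f x) ^+ 2)%:E))// => x _ /=.
rewrite ger0_norm ?exprMn//; apply: mulr_ge0; exact: sqr_ge0.
Qed.

Lemma L2B f g : L2 mu D f -> L2 mu D g -> L2 mu D (fun x => f x - g x).
Proof.
move=> L2f L2g; rewrite (_ : (fun x => _) = fun x => f x + (-1) * g x).
  by apply: L2D => //; exact: L2Z.
by apply/funext => x; rewrite mulN1r.
Qed.

Lemma L2_bounded f (M : R) : (mu D < +oo)%E -> measurable_fun D f ->
  (forall x, D x -> `|f x| <= M) -> L2 mu D f.
Proof.
move=> Doo mf fM; split => //.
apply: (@le_lt_trans _ _ (\int[mu]_(x in D) (cst (M ^+ 2)%:E) x)%E).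
  apply: ge0_le_integral => //.
  - by move=> x _; rewrite lee_fin sqr_ge0.
  - by apply/measurable_EFinP; exact: measurable_funX.
  - move=> x Dx; rewrite lee_fin -(real_normK (num_real (f x))).
    by rewrite lerXn2r ?nnegrE ?fM// (le_trans _ (fM x Dx)).
by rewrite integral_cst// lte_mul_pinfty// ?lee_fin ?sqr_ge0.
Qed.

End L2_functions.

Lemma L2_ae_eq d (T : measurableType d) (R : realType)
    (mu : {measure set T -> \bar R}) (D : set T) (f g : T -> R) :
  measurable D -> measurable_fun D g -> {ae mu, forall x, D x -> f x = g x} ->
  L2 mu D f -> L2 mu D g.
Proof.
move=> mD mg fg [mf fi]; split => //.
rewrite (ge0_ae_eq_integral mD (g := fun x => (f x ^+ 2)%:E)) //.
- by apply/measurable_EFinP; exact: measurable_funX.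
- by apply/measurable_EFinP; exact: measurable_funX.
- by move=> x _; rewrite lee_fin sqr_ge0.
- by move=> x _; rewrite lee_fin sqr_ge0.
- by apply: aeS fg => x /[apply] ->.
Qed.

Lemma ae_eq_Rintegral d (T : measurableType d) (R : realType)
    (mu : {measure set T -> \bar R}) (D : set T) (f g : T -> R) :
  measurable D -> measurable_fun D f -> measurable_fun D g ->
  {ae mu, forall x, D x -> f x = g x} ->
  \int[mu]_(x in D) f x = \int[mu]_(x in D) g x.
Proof.
move=> mD mf mg fg; congr fine; apply: ae_eq_integral => //.
- exact/measurable_EFinP.
- exact/measurable_EFinP.
- by apply: aeS fg => x /= h /h ->.
Qed.

Section Fubini.
Context d1 d2 (T1 : measurableType d1) (T2 : measurableType d2) (R : realType).
Variables (m1 : {sigma_finite_measure set T1 -> \bar R}).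
Variables (m2 : {sigma_finite_measure set T2 -> \bar R}).
Variables (D1 : set T1) (D2 : set T2).
Hypotheses (mD1 : measurable D1) (mD2 : measurable D2).

Lemma patch_setX (g : T1 * T2 -> R) x y :
  (g \_ (D1 `*` D2)) (x, y) =
  ((fun x => ((fun y => g (x, y)) \_ D2) y) \_ D1) x.
Proof.
rewrite !patchE; have -> : ((x, y) \in D1 `*` D2) = (x \in D1) && (y \in D2).
  by apply/idP/andP; rewrite !inE.
by case: (x \in D1) => //=.
Qed.

Let mD : measurable (D1 `*` D2). Proof. exact: measurableX. Qed.

Lemma integrable_patch (g : T1 * T2 -> R) :
  (m1 \x m2)%E.-integrable (D1 `*` D2) (EFin \o g) ->
  (m1 \x m2)%E.-integrable setT (EFin \o (g \_ (D1 `*` D2))).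
Proof. by rewrite (integrable_mkcond _ mD) restrict_EFin. Qed.

(* fine maps infinite inner integrals to 0, as does the real-valued integral,
   so the equality holds everywhere *)
Let patch_fubini_F (g : T1 * T2 -> R) :
  (fun x => \int[m2]_(y in D2) g (x, y)) \_ D1 =
  fine \o fubini_F m2 (EFin \o (g \_ (D1 `*` D2))).
Proof.
apply/funext => x; rewrite /= /fubini_F /=.
under eq_integral do rewrite patch_setX.
rewrite patchE; case: ifPn => xD.
  rewrite Rintegral_mkcond /Rintegral; congr fine; apply: eq_integral => y _.
  by rewrite [in RHS]patchE xD.
by rewrite integral0_eq// => y _; rewrite patchE (negbTE xD).
Qed.

Lemma Rintegral_fubini12 (g : T1 * T2 -> R) :
  (m1 \x m2)%E.-integrable (D1 `*` D2) (EFin \o g) ->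
  \int[(m1 \x m2)%E]_(z in D1 `*` D2) g z =
  \int[m1]_(x in D1) \int[m2]_(y in D2) g (x, y).
Proof.
move=> /integrable_patch gi; rewrite Rintegral_mkcond [RHS]Rintegral_mkcond.
rewrite {1}/Rintegral -(integral12_prod_meas1 gi); congr fine.
have Fi := integrable_fubini_F gi; rewrite patch_fubini_F.
apply: ae_eq_integral => //.
- exact: measurable_int Fi.
- apply/measurable_EFinP; apply: measurableT_comp => //; exact: measurable_int Fi.
- by apply: aeS (integrable_ae measurableT Fi) => x /= + _ => /(_ I)/fineK.
Qed.

Lemma integrable_fubini12 (g : T1 * T2 -> R) :
  (m1 \x m2)%E.-integrable (D1 `*` D2) (EFin \o g) ->
  m1.-integrable D1 (EFin \o (fun x => \int[m2]_(y in D2) g (x, y))).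
Proof.
move=> /integrable_patch gi; have Fi := integrable_fubini_F gi.
rewrite (integrable_mkcond _ mD1) restrict_EFin patch_fubini_F.
apply: (le_integrable measurableT _ _ Fi).
  by apply/measurable_EFinP; apply: measurableT_comp => //; exact: measurable_int Fi.
move=> x _ /=; case: fubini_F => [r| |] //=; exact: leey.
Qed.

Lemma ae_integrable_section (g : T1 * T2 -> R) :
  (m1 \x m2)%E.-integrable (D1 `*` D2) (EFin \o g) ->
  {ae m1, forall x, D1 x -> m2.-integrable D2 (EFin \o (fun y => g (x, y)))}.
Proof.
move=> /integrable_patch gi; apply: aeS (ae_integrable1 gi) => x h D1x.
rewrite (integrable_mkcond _ mD2) restrict_EFin; apply: eq_integrable h => // y _.
by rewrite /= patch_setX patchE mem_set.
Qed.

Let patch_fubini_G (g : T1 * T2 -> R) :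
  (fun y => \int[m1]_(x in D1) g (x, y)) \_ D2 =
  fine \o fubini_G m1 (EFin \o (g \_ (D1 `*` D2))).
Proof.
apply/funext => y; rewrite /= /fubini_G /=.
under eq_integral do rewrite patch_setX.
rewrite patchE; case: ifPn => yD.
  rewrite Rintegral_mkcond /Rintegral; congr fine; apply: eq_integral => x _.
  by rewrite !patchE yD.
rewrite integral0_eq// => x _.
by rewrite !patchE (negbTE yD) if_same.
Qed.

Let integrable_fubini_G (f : T1 * T2 -> \bar R) :
  (m1 \x m2)%E.-integrable setT f -> m2.-integrable setT (fubini_G m1 f).
Proof.
move=> fi; have mG := measurable_fubini_G fi; have mf := measurable_int _ fi.
apply/integrableP; split => //.
have /integrable21ltyP h := fi; apply: le_lt_trans (h mf).
apply: ge0_le_integral => //.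
- exact: measurableT_comp.
- apply: (@measurable_fun_fubini_tonelli_G _ _ _ _ _ m1 (abse \o f)).
  + exact: measurableT_comp.
  + by move=> z; exact: abse_ge0.
- by move=> y _; apply: le_abse_integral => //; apply: measurableT_comp.
Qed.

Lemma Rintegral_fubini21 (g : T1 * T2 -> R) :
  (m1 \x m2)%E.-integrable (D1 `*` D2) (EFin \o g) ->
  \int[(m1 \x m2)%E]_(z in D1 `*` D2) g z =
  \int[m2]_(y in D2) \int[m1]_(x in D1) g (x, y).
Proof.
move=> /integrable_patch gi; rewrite Rintegral_mkcond [RHS]Rintegral_mkcond.
rewrite {1}/Rintegral -(integral21_prod_meas1 gi); congr fine.
have Gi := integrable_fubini_G gi; rewrite patch_fubini_G.
apply: ae_eq_integral => //.
- exact: measurable_int Gi.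
- apply/measurable_EFinP; apply: measurableT_comp => //; exact: measurable_int Gi.
- by apply: aeS (integrable_ae measurableT Gi) => x /= + _ => /(_ I)/fineK.
Qed.

Lemma integrable_fubini21 (g : T1 * T2 -> R) :
  (m1 \x m2)%E.-integrable (D1 `*` D2) (EFin \o g) ->
  m2.-integrable D2 (EFin \o (fun y => \int[m1]_(x in D1) g (x, y))).
Proof.
move=> /integrable_patch gi; have Gi := integrable_fubini_G gi.
rewrite (integrable_mkcond _ mD2) restrict_EFin patch_fubini_G.
apply: (le_integrable measurableT _ _ Gi).
  by apply/measurable_EFinP; apply: measurableT_comp => //; exact: measurable_int Gi.
move=> x _ /=; case: fubini_G => [r| |] //=; exact: leey.
Qed.

(** Tonelli for a non-negative function of the first variable. *)
Lemma ge0_integral_cylinder (g : T1 -> R) :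
  measurable_fun D1 g -> (forall x, D1 x -> 0 <= g x) ->
  (\int[(m1 \x m2)%E]_(z in D1 `*` D2) (g z.1)%:E =
   \int[m1]_(x in D1) (g x)%:E * m2 D2)%E.
Proof.
move=> mg g0; rewrite integral_mkcond fubini_tonelli1/=; last 2 first.
- apply/(measurable_restrictT _ _).1 => //; apply/measurable_EFinP.
  have : measurable_fun (D1 `*` D2) (g \o fst).
    apply: (measurable_comp mD1) => //; last by apply: measurable_funTS; exact: measurable_fst.
    by move=> _ [x [? _] <-].
  exact.
- by move=> x; rewrite patchE; case: ifPn => // /set_mem[+ _]; rewrite lee_fin; exact: g0.
have mg' : measurable_fun D1 (EFin \o g) by exact/measurable_EFinP.
rewrite -(ge0_integralZr _ mD1 mg')//.
rewrite [RHS]integral_mkcond; apply: eq_integral => x _; rewrite /fubini_F patchE.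
case: ifPn => xD1.
  rewrite -integral_cst// [RHS]integral_mkcond; apply: eq_integral => y _.
  by rewrite !patchE in_setX xD1.
by apply: integral0_eq => y _; rewrite patchE in_setX (negbTE xD1).
Qed.

End Fubini.

(** * Test functions of one variable *)

Section one_dimensional_test_functions.
Variable R : realType.
Local Notation leb := (@lebesgue_measure R).
Implicit Types (J : set R) (b c : R -> R).

Lemma test1_measurable J c : test1 J c -> measurable_fun [set: measurableTypeR R] c.
Proof.
by move=> [sc _]; apply: continuous_measurable_fun; exact: smooth1_continuous.
Qed.

Lemma test1_integrable J c : test1 J c -> leb.-integrable setT (EFin \o c).
Proof.
move=> tc; have mc := test1_measurable tc; have [M cM] := test1_bounded tc.
have [sc [l [r [_ _ c0]]]] := tc.
have : leb.-integrable `[l, r] (EFin \o c).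
  apply: measurable_bounded_integrable => //.
  - by rewrite /= lebesgue_measure_itv/=; case: ifP => _; rewrite ltry.
  - exact: measurable_funTS.
  - exists M; split; first exact: num_real.
    by move=> y My x _; exact: le_trans (cM x) (ltW My).
rewrite integrable_mkcond//; apply: eq_integrable => //= t _.
rewrite patchE; case: ifPn => // tlr; rewrite /= c0// => h.
by move/negP: tlr; apply; rewrite inE/= in_itv.
Qed.

Lemma test1_integralJ J c : test1 J c ->
  \int[leb]_(t in J) c t = \int[leb]_t c t.
Proof.
move=> [_ [l [r [_ lrJ c0]]]]; rewrite Rintegral_mkcond; apply: eq_Rintegral => t _.
rewrite patchE; case: ifPn => // /negP tJ; rewrite c0// => h; apply: tJ.
by rewrite inE; apply: lrJ; rewrite /= in_itv.
Qed.

Lemma test1_derive J c : test1 J c -> test1 J ('D_1 c).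
Proof.
move=> [sc [l [r [lr lrJ c0]]]]; split; first exact: smooth1_derive.
exists l, r; split => // t nt.
rewrite (@near_eq_derive _ _ _ c (cst 0)); first exact: derive_cst.
have : \forall u \near t, (~` `[l, r]) u.
  apply: open_nbhs_nbhs; split; last by rewrite /= in_itv.
  by apply: closed_openC; exact: interval_closed.
by apply: filterS => u /=; rewrite in_itv/=; exact: c0.
Qed.

Lemma test1_lin J (a a' : R) b c : is_interval J -> test1 J b -> test1 J c ->
  test1 J (fun t => a * b t + a' * c t).
Proof.
move=> iJ [sb [l1 [r1 [lr1 lr1J b0]]]] [sc [l2 [r2 [lr2 lr2J c0]]]]; split.
  by move=> k; apply: DnD; apply: DnZ; [exact: sb|exact: sc].
exists (Num.min l1 l2), (Num.max r1 r2); split.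
- by rewrite ge_min le_max lr1.
- move=> t /=; rewrite in_itv/= => tlr; apply: iJ tlr.
    rewrite minEle; case: ifP => _; [apply: lr1J|apply: lr2J];
      by rewrite /= in_itv/= lexx.
  rewrite maxEle; case: ifP => _; [apply: lr2J|apply: lr1J];
    by rewrite /= in_itv/= lexx andbT.
- move=> t nt; rewrite b0 ?c0 ?mulr0 ?addr0// => /andP[h1 h2]; apply: nt;
    by rewrite ge_min le_max h1 h2 ?orbT.
Qed.

(** A test function of integral zero is the derivative of a test function. *)
Lemma test1_primitive J c : test1 J c -> \int[leb]_t c t = 0 ->
  exists C, test1 J C /\ 'D_1 C = c.
Proof.
move=> tc c0; have [sc [l [r [lr lrJ cout]]]] := tc.
have ci := test1_integrable tc.
pose C x : R := \int[leb]_(t in `]-oo, x]) c t.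
have dC x : is_derive x (1 : R) C (c x).
  have h : leb.-integrable `]-oo, (x + 1)] (EFin \o c) by apply: integrableS ci.
  have xx1 : x < x + 1 by rewrite ltrDl.
  have [d1 d2] := continuous_FTC1 xx1 h (ltNyr _) (smooth1_continuous sc (x := x)).
  by split => //; rewrite -derive1E.
exists C; split; last by apply/funext => x; have [_ ->] := dC x.
split; first by case=> [//|k]; exists c.
exists l, r; split => // t nt; rewrite /C.
have [tl|lt] := ltP t l.
  rewrite /Rintegral integral0_eq// => u /=; rewrite in_itv/= => ut.
  by rewrite cout// => /andP[lu _]; move: (le_lt_trans (le_trans lu ut) tl); rewrite ltxx.
rewrite -[RHS]c0 Rintegral_mkcond; apply: eq_Rintegral => u _.
rewrite patchE; case: ifPn => // /negP ut; rewrite cout// => /andP[_ ur].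
apply: nt; rewrite lt/= leNgt; apply/negP => rt; apply: ut.
by rewrite inE/= in_itv/= (le_trans ur)// ltW.
Qed.

Lemma cutoff_test1 J (s l r : R) : 0 < s -> l < r -> `[l, r] `<=` J ->
  test1 J (cutoff s l r).
Proof.
move=> s0 lr lrJ; split; first exact: cutoff_smooth.
exists l, r; split => //; first exact: ltW.
move=> t nt; rewrite cutoffE; case: ifPn => // /andP[/ltW h1 /ltW h2].
by case: nt; rewrite h1 h2.
Qed.

(** On [l + d, r - d] both exponential factors are at least exp(-1/d).  The
    bound is trivial if this segment is empty. *)
Lemma cutoff_integral_ge (l r d : R) : 0 < d -> l < r ->
  expR (- d^-1) ^+ 2 * (r - l - 2 * d) <= \int[leb]_t cutoff 1 l r t.
Proof.
move=> d0 lr; have ci : leb.-integrable setT (EFin \o cutoff 1 l r).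
  by apply: (@test1_integrable setT); exact: cutoff_test1.
have I0 : 0 <= \int[leb]_t cutoff 1 l r t.
  by apply: Rintegral_ge0 => t _; exact: cutoff_ge0.
have [rl|lr2] := leP (r - l - 2 * d) 0.
  by apply: le_trans I0; rewrite mulr_ge0_le0// sqr_ge0.
have lr1 : l + d < r - d by lra.
apply: (@le_trans _ _ (\int[leb]_(t in `[l + d, r - d]) (expR (- d^-1) ^+ 2))).
  rewrite Rintegral_cst//= lebesgue_measure_itv/= lte_fin lr1 -EFinD/=.
  rewrite (_ : r - d - (l + d) = r - l - 2 * d) //; by ring.
apply: (@le_trans _ _ (\int[leb]_(t in `[l + d, r - d]) cutoff 1 l r t)).
  apply: le_Rintegral => //.
  - apply: measurable_bounded_integrable => //.
      by rewrite /= lebesgue_measure_itv/= lte_fin lr1 ltry.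
    exists (expR (- d^-1) ^+ 2); split; first exact: num_real.
    by move=> y /ltW + x _; rewrite ger0_norm// sqr_ge0.
  - by apply: integrableS ci.
  - move=> t; rewrite /= in_itv/= => /andP[h1 h2]; rewrite cutoffE ifT; last first.
      by apply/andP; split; lra.
    have h (x : R) : d <= x -> expR (- d^-1) <= expR (- (1 * x^-1)).
      move=> dx; rewrite ler_expR lerN2 mul1r lef_pV2// posrE.
      by rewrite (lt_le_trans d0).
    by rewrite expr2 ler_pM ?expR_ge0// h//; lra.
rewrite Rintegral_mkcond; apply: le_Rintegral => //.
- by rewrite -restrict_EFin; rewrite -integrable_mkcond//; apply: integrableS ci.
- by move=> t _; rewrite patchE; case: ifP => // _; exact: cutoff_ge0.
Qed.

Lemma test1_unit_mass (l r : R) : l < r ->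
  exists c, test1 `]l, r[ c /\ \int[leb]_t c t = 1.
Proof.
move=> lr; pose d := (r - l) / 8.
have d0 : 0 < d by rewrite divr_gt0// subr_gt0.
have lr' : l + d < r - d by rewrite /d; lra.
have tk : test1 `]l, r[ (cutoff 1 (l + d) (r - d)).
  by apply: cutoff_test1 => // t; rewrite /= !in_itv/= => /andP[h1 h2]; apply/andP; split; lra.
have k0 : 0 < \int[leb]_t cutoff 1 (l + d) (r - d) t.
  apply: lt_le_trans (cutoff_integral_ge d0 lr'); apply: mulr_gt0.
    by rewrite exprn_gt0// expR_gt0.
  by rewrite /d; lra.
set k := \int[leb]_t _ in k0.
exists (fun t => k^-1 * cutoff 1 (l + d) (r - d) t + 0 * cutoff 1 (l + d) (r - d) t).
split; first by apply: test1_lin => //; exact: interval_is_interval.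
under eq_Rintegral do rewrite mul0r addr0.
by rewrite RintegralZl ?mulVf ?gt_eqF//; exact: test1_integrable tk.
Qed.

End one_dimensional_test_functions.

(** * Cauchy-Schwarz; test functions are square integrable *)

Lemma L2S d (T : measurableType d) (R : realType)
    (mu : {measure set T -> \bar R}) (D E : set T) (f : T -> R) :
  measurable D -> measurable E -> D `<=` E -> L2 mu E f -> L2 mu D f.
Proof.
move=> mD mE DE [mf fi]; split; first exact: measurable_funS mf.
apply: le_lt_trans fi; apply: ge0_subset_integral => //.
- by apply/measurable_EFinP; exact: measurable_funX.
- by move=> x _; rewrite lee_fin sqr_ge0.
Qed.

(** By the discriminant of t |-> int (t f + g)^2. *)
Lemma Cauchy_Schwarz d (T : measurableType d) (R : realType)
    (mu : {measure set T -> \bar R}) (D : set T) (f g : T -> R) :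
  measurable D -> L2 mu D f -> L2 mu D g ->
  (\int[mu]_(x in D) (f x * g x)) ^+ 2 <=
  (\int[mu]_(x in D) (f x ^+ 2)) * (\int[mu]_(x in D) (g x ^+ 2)).
Proof.
move=> mD L2f L2g; set b := \int[mu]_(x in D) (f x * g x).
set a := \int[mu]_(x in D) (f x ^+ 2); set c := \int[mu]_(x in D) (g x ^+ 2).
have q t : 0 <= t ^+ 2 * a + 2 * t * b + c.
  have fi := L2_sqr_integrable L2f; have gi := L2_sqr_integrable L2g.
  have fgi := L2_mul_integrable mD L2f L2g.
  have fi' : mu.-integrable D (EFin \o (fun x => t ^+ 2 * f x ^+ 2)).
    exact: (integrableZl mD (t ^+ 2) fi).
  have fgi' : mu.-integrable D (EFin \o (fun x => 2 * t * (f x * g x))).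
    exact: (integrableZl mD (2 * t) fgi).
  rewrite -RintegralZl// -RintegralZl// -RintegralD//.
  rewrite -RintegralD//; last exact: (integrableD mD fi' fgi').
  apply: Rintegral_ge0 => x _.
  rewrite (_ : _ + _ = (t * f x + g x) ^+ 2) ?sqr_ge0//; ring.
have a0 : 0 <= a by apply: Rintegral_ge0 => x _; exact: sqr_ge0.
have c0 : 0 <= c by apply: Rintegral_ge0 => x _; exact: sqr_ge0.
have [a00|an0] := eqVneq a 0.
  have [->|bn0] := eqVneq b 0; first by rewrite expr0n/= mulr_ge0.
  (* if b <> 0, the affine function 2 t b + c takes the value -1 *)
  have := q (- (c + 1) / (2 * b)); rewrite a00 mulr0 add0r.
  rewrite (_ : 2 * (- (c + 1) / (2 * b)) * b = - (c + 1)); last by field.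
  by lra.
have ap : 0 < a by rewrite lt_neqAle eq_sym an0.
have := q (- b / a).
rewrite (_ : _ + c = (a * c - b ^+ 2) / a); last by field.
by rewrite pmulr_lge0 ?invr_gt0// subr_ge0.
Qed.

Section test_functions_are_L2.
Variable R : realType.

(** A compact set is contained in a cube. *)
Lemma compact_cbox (K : set (space R)) : compact K ->
  exists M : R, K `<=` cbox (- M, - M, - M) (M, M, M).
Proof.
move=> Kc; have b (f : space R -> R) : continuous f -> exists M, forall x, K x -> `|f x| <= M.
  move=> cf; have : compact (f @` K).
    by apply: continuous_compact => //; exact: continuous_subspaceT.
  move=> /compact_bounded[M [_ Mf]]; exists (`|M| + 1) => x Kx.
  apply: (Mf (`|M| + 1)); last by exists x.
  by rewrite (le_lt_trans (ler_norm _))// ltrDl.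
have [M1 h1] : exists M, forall x, K x -> `|x.1.1| <= M.
  by apply: b => x; apply: (continuous_comp (f := fst)); exact: cvg_fst.
have [M2 h2] : exists M, forall x, K x -> `|x.1.2| <= M.
  by apply: b => x; apply: (continuous_comp (f := fst)); [exact: cvg_fst|exact: cvg_snd].
have [M3 h3] : exists M, forall x, K x -> `|x.2| <= M.
  by apply: b => x; exact: cvg_snd.
exists (`|M1| + `|M2| + `|M3|) => x Kx; split; [split|]; rewrite /= in_itv/= -ler_norml.
- by rewrite (le_trans (h1 _ Kx))// (le_trans (ler_norm _))// -addrA lerDl addr_ge0.
- by rewrite (le_trans (h2 _ Kx))// (le_trans (ler_norm _))// addrAC lerDr addr_ge0.
- by rewrite (le_trans (h3 _ Kx))// (le_trans (ler_norm _))// lerDr addr_ge0.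
Qed.

Lemma leb3_cbox_lty (l r : space R) : (leb3 R (cbox l r) < +oo)%E.
Proof.
have i (a b : R) : (@lebesgue_measure R `[a, b] < +oo)%E.
  by rewrite /= lebesgue_measure_itv/=; case: ifP => _; rewrite ltry.
have e : leb2 R (`[l.1.1, r.1.1] `*` `[l.1.2, r.1.2]) =
   (@lebesgue_measure R `[l.1.1, r.1.1] * @lebesgue_measure R `[l.1.2, r.1.2])%E.
  by rewrite /leb2 product_measure1E.
rewrite /leb3 /cbox product_measure1E//=; last exact: measurableX.
have fi (a b : R) : (@lebesgue_measure R `[a, b])%E \is a fin_num.
  by rewrite ge0_fin_numE.
by rewrite e ltey_eq !fin_numM.
Qed.

Lemma test3_measurable Om (psi : space R -> R) : test3 Om psi ->
  measurable_fun [set: mspace R] psi.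
Proof. by move=> [cf _]; apply: continuous_measurable3; exact: Ck_continuous (cf 0%N). Qed.

Lemma test3_L2 Om (psi : space R -> R) : test3 Om psi -> L2 (leb3 R) setT psi.
Proof.
move=> tpsi; have mpsi := test3_measurable tpsi; split => //.
have [M psiM] := test_function_bounded tpsi.
have [_ [K [Kc _ psi0]]] := tpsi; have [N KN] := compact_cbox Kc.
set Q := cbox _ _ in KN; have mQ : measurable (Q : set (mspace R)).
  by apply: measurableX => //; exact: measurableX.
have [_ ] : L2 (leb3 R) Q psi.
  apply: (@L2_bounded _ _ _ _ _ _ _ M) => //; first exact: leb3_cbox_lty.
  exact: measurable_funTS.
rewrite integral_mkcond; congr (_ < _)%E; apply: eq_integral => x _.
rewrite patchE; case: ifPn => // /negP xQ; rewrite psi0 ?expr0n// => Kx.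
by apply: xQ; rewrite inE; exact: KN.
Qed.

Lemma test2_measurable om (A : plane R -> R) : test2 om A ->
  measurable_fun [set: mplane R] A.
Proof. by move=> [cf _]; apply: continuous_measurable2; exact: Ck_continuous (cf 0%N). Qed.

Lemma test2_L2 om (A : plane R -> R) : test2 om A -> L2 (leb2 R) setT A.
Proof.
move=> tA; have mA := test2_measurable tA; split => //.
have [M AM] := test_function_bounded tA.
have [_ [K [Kc _ A0]]] := tA.
have [N KN] : exists N : R, K `*` `[(0 : R), 0] `<=` cbox (- N, - N, - N) (N, N, N).
  by apply: compact_cbox; apply: compact_setX => //; exact: segment_compact.
set Q : set (plane R) := `[- N, N] `*` `[- N, N].
have mQ : measurable (Q : set (mplane R)) by exact: measurableX.
have [_ ] : L2 (leb2 R) Q A.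
  apply: (@L2_bounded _ _ _ _ _ _ _ M) => //; last exact: measurable_funTS.
  have E : leb2 R Q = (@lebesgue_measure R `[(- N)%R, N] * @lebesgue_measure R `[(- N)%R, N])%E.
    by rewrite /leb2 product_measure1E.
  rewrite [X in (X < _)%E]E lebesgue_measure_itv/=.
  by case: ifPn => _; rewrite ?mul0e// -EFinD -EFinM ltry.
rewrite integral_mkcond; congr (_ < _)%E; apply: eq_integral => x _.
rewrite patchE; case: ifPn => // /negP xQ; rewrite A0 ?expr0n// => Kx.
have Kx0 : (K `*` `[(0 : R), 0]) (x, (0 : R)) by split => //=; rewrite in_itv/= lexx.
by apply: xQ; rewrite inE; have [] := KN _ Kx0.
Qed.

End test_functions_are_L2.

(** * Functions with vanishing third derivative *)

Section functions_with_vanishing_third_derivative.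
Variable R : realType.
Local Notation leb := (@lebesgue_measure R).
Variables (om : set (plane R)) (J : set R).
Hypotheses (oom : open om) (oJ : open J) (iJ : is_interval J).
Let D : set (space R) := om `*` J.
Implicit Types (f : space R -> R) (A : plane R -> R) (c : R -> R).

(** The weak third derivative of f vanishes in om x J, tested against tensor
    products only. *)
Definition vanishing_d3 f : Prop := forall A c, test2 om A -> test1 J c ->
  \int[leb3 R]_(x in D) (f x * (A x.1 * 'D_1 c x.2)) = 0.

Lemma measurable_cylinder : measurable (D : set (mspace R)).
Proof. by apply: open_measurable3; exact: open_setX. Qed.

Lemma test_L2 A c : test2 om A -> test1 J c ->
  L2 (leb3 R) D (fun x => A x.1 * c x.2).
Proof.
move=> tA tc; apply: (@L2S _ _ _ _ _ setT) => //; first exact: measurable_cylinder.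
exact: test3_L2 (test3_tensor tA tc).
Qed.

(** The integral of f against A(x') b(x_3) depends on b only through its
    integral. *)
Lemma vanishing_d3_exchange f : L2 (leb3 R) D f -> vanishing_d3 f ->
  forall A b c, test2 om A -> test1 J b -> test1 J c ->
  \int[leb]_t c t * \int[leb3 R]_(x in D) (f x * (A x.1 * b x.2)) =
  \int[leb]_t b t * \int[leb3 R]_(x in D) (f x * (A x.1 * c x.2)).
Proof.
move=> L2f f0 A b c tA tb tc; have mD := measurable_cylinder.
set ic := \int[leb]_t c t; set ib := \int[leb]_t b t.
have bi := test1_integrable tb; have ci := test1_integrable tc.
have tg := test1_lin ic (- ib) iJ tb tc.
have [] := @test1_primitive _ J _ tg.
  rewrite RintegralD//=; last 2 first.
  - exact: (integrableZl measurableT ic bi).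
  - exact: (integrableZl measurableT (- ib) ci).
  by rewrite !RintegralZl// -/ib -/ic mulNr mulrC subrr.
move=> C [tC dC]; have := f0 A C tA tC.
have {}dC t : 'D_1 C t = ic * b t + - ib * c t.
  by rewrite -[LHS]/(('D_1 C) t) dC.
have i1 := L2_mul_integrable mD L2f (test_L2 tA tb).
have i2 := L2_mul_integrable mD L2f (test_L2 tA tc).
rewrite (@eq_Rintegral _ _ _ (leb3 R) D (fun x : mspace R =>
    ic * (f x * (A x.1 * b x.2)) - ib * (f x * (A x.1 * c x.2)))).
  rewrite RintegralB//; last 2 first.
  - exact: (integrableZl mD ic i1).
  - exact: (integrableZl mD ib i2).
  by rewrite !RintegralZl// => /eqP; rewrite subr_eq0 => /eqP.
by move=> x _; rewrite dC; ring.
Qed.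

End functions_with_vanishing_third_derivative.

Section vanishing_third_derivative_in_the_whole_space.
Variable R : realType.
Local Notation leb := (@lebesgue_measure R).

(** The cut-off function of a box whose closed box lies in om x J is a tensor
    product of test functions on om and on J. *)
Lemma cutoff3_tensor (om : set (plane R)) (J : set R) (l r : space R) (s : R) :
  cbox l r `<=` om `*` J -> obox l r !=set0 -> 0 < s ->
  test2 om (fun y : plane R => cutoff s l.1.1 r.1.1 y.1 * cutoff s l.1.2 r.1.2 y.2) /\
  test1 J (cutoff s l.2 r.2).
Proof.
move=> lrD [x0 [[/= + +] +]] s0; rewrite !in_itv/=.
move=> /andP[a1 b1] /andP[a2 b2] /andP[a3 b3].
have [h1 h2 h3] : [/\ l.1.1 < r.1.1, l.1.2 < r.1.2 & l.2 < r.2].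
  by split; [exact: lt_trans b1|exact: lt_trans b2|exact: lt_trans b3].
have out (a b t : R) : ~ (a <= t <= b) -> cutoff s a b t = 0.
  by move=> nt; rewrite cutoffE; case: ifPn => // /andP[/ltW u /ltW v]; case: nt; rewrite u v.
split.
  apply: (@test2_tensor _ _ _ _ l.1.1 r.1.1 l.1.2 r.1.2).
  - exact: cutoff_smooth.
  - exact: cutoff_smooth.
  - move=> y hy; suff [] : (om `*` J) (y, l.2) by [].
    by apply: lrD; split => //=; rewrite in_itv/= lexx ltW.
  - exact: out.
  - exact: out.
apply: cutoff_test1 => // t ht; suff [] : (om `*` J) (l.1, t) by [].
by apply: lrD; split; [split|] => //=; rewrite in_itv/= lexx ltW.
Qed.

Lemma L2_box_integrable (Om : set (space R)) (f : space R -> R) l r :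
  measurable (Om : set (mspace R)) -> L2 (leb3 R) Om f -> cbox l r `<=` Om ->
  (leb3 R).-integrable (obox l r) (EFin \o f).
Proof.
move=> mOm L2f lrOm; have mQ := @measurable_obox R l r.
have Qoo : (leb3 R (obox l r) < +oo)%E.
  apply: le_lt_trans (leb3_cbox_lty l r); apply: le_measure; rewrite ?inE//.
    by apply: measurableX => //; exact: measurableX.
  exact: obox_sub.
have L2f' : L2 (leb3 R) (obox l r) f.
  by apply: L2S L2f => // x /obox_sub; exact: lrOm.
have L21 : L2 (leb3 R) (obox l r) (cst 1).
  by apply: (@L2_bounded _ _ _ _ _ _ _ 1) => // x _; rewrite normr1.
have := L2_mul_integrable mQ L2f' L21.
by apply: eq_integrable => // x _; rewrite /= mulr1.
Qed.

(** A square integrable function on space with vanishing third derivative is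
    zero. *)
Lemma vanishing_d3_whole_space (f : space R -> R) : L2 (leb3 R) setT f ->
  vanishing_d3 setT setT f -> {ae leb3 R, forall x, f x = 0}.
Proof.
move=> L2f f0; have [mf _] := L2f.
have DT : [set: plane R] `*` [set: R] = setT by rewrite setXTT.
have L2f' : L2 (leb3 R) (setT `*` setT) f by rewrite DT.
suff : {ae leb3 R, forall x, setT x -> f x = 0} by apply: aeS => x; exact.
apply: cutoff_integrals_eq0 => //; first exact: openT.
  move=> l r lrT; apply: L2_box_integrable lrT => //.
move=> l r s lrT lr0 s0.
have [tA tb] := @cutoff3_tensor setT setT l r s (fun _ _ => conj I I) lr0 s0.
set A := (fun y => _) in tA; set b := cutoff _ _ _ in tb.
(* the third factor b is traded for wider and wider cut-off functions; with
   n + 3 in the upper end their mass is at least exp(-1)^2 (n + 1) > 0 *)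
pose c (n : nat) := cutoff 1 0 n.+3%:R : R -> R.
have tc n : test1 setT (c n) by apply: cutoff_test1.
have iT : is_interval [set: R] by [].
have ex := vanishing_d3_exchange (@openT _) (@openT _) iT L2f' f0 tA tb.
have mT : measurable ([set: plane R] `*` [set: R] : set (mspace R)) by rewrite DT.
pose F := \int[leb3 R]_(x in setT `*` setT) (f x ^+ 2).
pose K := \int[leb2 R]_y (A y ^+ 2).
pose S n := \int[leb]_t c n t.
pose B := \int[leb]_t b t.
have AcE n : \int[leb3 R]_(x in setT `*` setT) ((A x.1 * c n x.2) ^+ 2) <= K * S n.
  have L2Ac := test_L2 (@openT _) (@openT _) tA (tc n).
  rewrite /leb3 Rintegral_fubini12//; last exact: L2_sqr_integrable L2Ac.
  have ci := test1_integrable (tc n).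
  have c2i : leb.-integrable setT (EFin \o (fun t => c n t ^+ 2)).
    apply: (le_integrable measurableT _ _ ci).
      apply/measurable_EFinP; apply: measurable_funX; exact: test1_measurable (tc n).
    move=> t _ /=; rewrite lee_fin !ger0_norm ?sqr_ge0 ?cutoff_ge0//.
    by rewrite expr2 ler_piMl ?cutoff_ge0// cutoff_le1.
  have A2i : (leb2 R).-integrable setT (EFin \o (fun y => A y ^+ 2)).
    exact: L2_sqr_integrable (test2_L2 tA).
  under eq_Rintegral => y _.
    under eq_Rintegral => t _ do rewrite exprMn /=.
    rewrite RintegralZl//; over.
  rewrite RintegralZr// ler_wpM2l//.
    by apply: Rintegral_ge0 => y _; exact: sqr_ge0.
  apply: le_Rintegral => // t _.
  by rewrite expr2 ler_piMl ?cutoff_ge0// cutoff_le1.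
have Sge n : expR (- 1) ^+ 2 * n.+1%:R <= S n.
  have := @cutoff_integral_ge R 0 n.+3%:R 1 ltr01 (ltr0Sn _ _).
  by rewrite subr0 invr1 mulr1 (_ : n.+3%:R - 2 = n.+1%:R)// -[n.+3]addn2 natrD addrK.
have e0 : 0 < expR (- 1) ^+ 2 :> R by rewrite exprn_gt0// expR_gt0.
have S0 n : 0 < S n by apply: lt_le_trans (Sge n); rewrite mulr_gt0.
have -> : \int[leb3 R]_x (f x * cutoff3 s l r x) =
  \int[leb3 R]_(x in setT `*` setT) (f x * (A x.1 * b x.2)) by rewrite DT.
set I0 := \int[leb3 R]_(x in _) _.
have F0 : 0 <= F by apply: Rintegral_ge0 => x _; exact: sqr_ge0.
have K0 : 0 <= K by apply: Rintegral_ge0 => x _; exact: sqr_ge0.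
have bound n : S n * I0 ^+ 2 <= B ^+ 2 * (F * K).
  have /(congr1 (fun z => z ^+ 2)) := ex (c n) (tc n).
  rewrite -/(S n) -/B -/I0 !exprMn => E.
  have CS := Cauchy_Schwarz mT L2f' (test_L2 (@openT _) (@openT _) tA (tc n)).
  have {CS} : S n ^+ 2 * I0 ^+ 2 <= B ^+ 2 * (F * (K * S n)).
    rewrite E ler_wpM2l ?sqr_ge0//; apply: le_trans CS _.
    by rewrite ler_wpM2l// AcE.
  rewrite (_ : S n ^+ 2 * I0 ^+ 2 = S n * I0 ^+ 2 * S n); last by ring.
  rewrite (_ : B ^+ 2 * (F * (K * S n)) = B ^+ 2 * (F * K) * S n); last by ring.
  by rewrite ler_pM2r.
apply/eqP; apply: contraT => I00.
have I2 : 0 < expR (- 1) ^+ 2 * I0 ^+ 2 by rewrite mulr_gt0// exprn_even_gt0.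
have x0 : 0 <= B ^+ 2 * (F * K) / (expR (- 1) ^+ 2 * I0 ^+ 2).
  by rewrite divr_ge0 ?(ltW I2)// mulr_ge0 ?sqr_ge0// mulr_ge0.
have := archi_boundP x0; set N := Num.bound _; rewrite ltr_pdivrMr//.
apply/contraLR => _; rewrite -leNgt; apply: le_trans (bound N).
rewrite mulrA ler_wpM2r ?sqr_ge0//; apply: le_trans (Sge N).
by rewrite mulrC ler_wpM2l ?(ltW e0)// ler_nat.
Qed.

End vanishing_third_derivative_in_the_whole_space.

(** * Cylindrical functions in the slab *)

Section vanishing_third_derivative_in_a_slab.
Variable R : realType.
Local Notation leb := (@lebesgue_measure R).
Variable om : set (plane R).
Hypotheses (oom : open om) (om_fin : (leb2 R om < +oo)%E).
Local Notation J := (`]0, 1[%classic : set R).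

Let mom : measurable (om : set (mplane R)).
Proof. exact: open_measurable2. Qed.

Let mJ : measurable (J : set (measurableTypeR R)).
Proof. exact: measurable_itv. Qed.

Lemma leb_unit_itv : leb J = 1%E.
Proof. by rewrite /= lebesgue_measure_itv/= lte_fin ltr01 oppr0 adde0. Qed.

Lemma measurable_slab : measurable (slab om : set (mspace R)).
Proof. exact: measurableX. Qed.

Lemma ge0_integral_slab (g : plane R -> R) :
  measurable_fun om (g : mplane R -> R) -> (forall x, om x -> 0 <= g x) ->
  (\int[leb3 R]_(z in slab om) (g z.1)%:E = \int[leb2 R]_(x in om) (g x)%:E)%E.
Proof.
move=> mg g0; rewrite /leb3 /slab ge0_integral_cylinder//.
by rewrite [X in (_ * X)%E]leb_unit_itv mule1.
Qed.

Lemma measurable_fun_cylinder (g : plane R -> R) :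
  measurable_fun om (g : mplane R -> R) ->
  measurable_fun (slab om) (fun x : mspace R => g x.1).
Proof.
move=> mg; apply: (measurable_comp mom) => //.
  by move=> _ [x [? _] <-].
by apply: measurable_funTS; exact: measurable_fst.
Qed.

Lemma L2_cylinder (g : plane R -> R) :
  measurable_fun om (g : mplane R -> R) ->
  L2 (leb2 R) om g <-> L2 (leb3 R) (slab om) (fun x => g x.1).
Proof.
move=> mg.
have E := ge0_integral_slab (measurable_funX 2 mg) (fun x _ => sqr_ge0 (g x)).
split=> [[_ gi]|[_ gi]]; split => //.
- exact: measurable_fun_cylinder.
- by rewrite [X in (X < _)%E]E.
- by rewrite -[X in (X < _)%E]E.
Qed.

Lemma integrable_cylinder (g : plane R -> R) :
  (leb2 R).-integrable om (EFin \o g) ->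
  (leb3 R).-integrable (slab om) (EFin \o (fun x => g x.1)).
Proof.
move=> /integrableP[/measurable_EFinP mg gi]; apply/integrableP; split.
  by apply/measurable_EFinP; exact: measurable_fun_cylinder.
have E := ge0_integral_slab (measurableT_comp (@normr_measurable R setT) mg)
  (fun x _ => normr_ge0 (g x)).
by move: gi; rewrite -[X in (X < _)%E]E.
Qed.

Lemma leb3_slab_lty : (leb3 R (slab om) < +oo)%E.
Proof.
have -> : leb3 R (slab om) = (leb2 R om * leb J)%E.
  by rewrite /leb3 /slab product_measure1E.
by rewrite [X in (_ * X)%E]leb_unit_itv mule1.
Qed.

Lemma L2_slab_integrable (f : space R -> R) :
  L2 (leb3 R) (slab om) f -> (leb3 R).-integrable (slab om) (EFin \o f).
Proof.
move=> L2f; have L21 : L2 (leb3 R) (slab om) (cst 1).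
  apply: (@L2_bounded _ _ _ _ _ measurable_slab _ 1) => //; first exact: leb3_slab_lty.
  by move=> x _; rewrite normr1.
have := L2_mul_integrable measurable_slab L2f L21.
by apply: eq_integrable; [exact: measurable_slab|move=> x _; rewrite /= mulr1].
Qed.

Lemma Rintegral_slab12 (f : space R -> R) :
  (leb3 R).-integrable (slab om) (EFin \o f) ->
  \int[leb3 R]_(x in slab om) f x =
  \int[leb2 R]_(y in om) \int[leb]_(t in J) f (y, t).
Proof. by move=> fi; rewrite /leb3 Rintegral_fubini12. Qed.

Lemma Rintegral_slab21 (f : space R -> R) :
  (leb3 R).-integrable (slab om) (EFin \o f) ->
  \int[leb3 R]_(x in slab om) f x =
  \int[leb]_(t in J) \int[leb2 R]_(y in om) f (y, t).
Proof. by move=> fi; rewrite /leb3 Rintegral_fubini21. Qed.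

Lemma Rintegral_slab_tensor (q : plane R -> R) (b : R -> R) :
  (leb3 R).-integrable (slab om) (EFin \o (fun x => q x.1 * b x.2)) ->
  (leb2 R).-integrable om (EFin \o q) -> test1 J b ->
  \int[leb3 R]_(x in slab om) (q x.1 * b x.2) =
  \int[leb2 R]_(y in om) q y * \int[leb]_t b t.
Proof.
move=> qbi qi tb; rewrite Rintegral_slab12//=.
have bi : leb.-integrable J (EFin \o b) by apply: integrableS (test1_integrable tb).
under eq_Rintegral => y _ do rewrite RintegralZl//.
by rewrite RintegralZr// (test1_integralJ tb).
Qed.

Lemma test2_mul_integrable (q A : plane R -> R) :
  L2 (leb2 R) om q -> test2 om A ->
  (leb2 R).-integrable om (EFin \o (fun x => q x * A x)).
Proof.
move=> L2q tA; apply: L2_mul_integrable => //.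
by apply: L2S (test2_L2 tA).
Qed.

(** A square integrable function on the slab with vanishing third derivative
    depends on x' only, almost everywhere. *)
Lemma slab_cylinder (f : space R -> R) : L2 (leb3 R) (slab om) f ->
  vanishing_d3 om J f -> exists q : plane R -> R, L2 (leb2 R) om q /\
    {ae leb3 R, forall x, slab om x -> f x = q x.1}.
Proof.
move=> L2f f0; have [c0 [tc0 ic0]] := @test1_unit_mass R 0 1 ltr01.
have oJ : open J by exact: interval_open.
have iJ : is_interval J by exact: interval_is_interval.
have mD := measurable_slab.
have ex A b tA tb := @vanishing_d3_exchange R om J oom oJ iJ f L2f f0 A b c0 tA tb tc0.
pose q y := \int[leb]_(t in J) (f (y, t) * c0 t).
have mc0 : measurable_fun (slab om) (fun x : mspace R => c0 x.2).
  apply: measurable_funTS; apply: (measurableT_comp (test1_measurable tc0)).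
  exact: measurable_snd.
have L2c0 : L2 (leb3 R) (slab om) (fun x => c0 x.2).
  have [M cM] := test1_bounded tc0.
  by apply: (@L2_bounded _ _ _ _ _ _ _ M) => //; exact: leb3_slab_lty.
have fci := L2_mul_integrable mD L2f L2c0.
have qi : (leb2 R).-integrable om (EFin \o q).
  exact: (@integrable_fubini12 _ _ _ _ R (leb2 R) leb om J mom mJ _ fci).
have mq : measurable_fun om (q : mplane R -> R).
  by apply/measurable_EFinP; exact: measurable_int qi.
have fi := L2_slab_integrable L2f.
have qi3 := integrable_cylinder qi.
have aefq : {ae leb3 R, forall x, slab om x -> f x - q x.1 = 0}.
  apply: cutoff_integrals_eq0.
  - exact: open_setX.
  - apply: measurable_funB; last exact: measurable_fun_cylinder.
    by have [] := L2f.
  - move=> l r lrD; apply: (integrableS mD (measurable_obox l r)).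
    + by move=> x /obox_sub; exact: lrD.
    + exact: (integrableB mD fi qi3).
  move=> l r s lrD lr0 s0.
  have [tA tb] := cutoff3_tensor lrD lr0 s0.
  set A := (fun y => _) in tA; set b := cutoff _ _ _ in tb.
  have L2Ab := test_L2 oom oJ tA tb; have L2Ac := test_L2 oom oJ tA tc0.
  have fAb := L2_mul_integrable mD L2f L2Ab.
  have fAc := L2_mul_integrable mD L2f L2Ac.
  have [M AbM] := test_function_bounded (test3_tensor tA tb).
  have qAb : (leb3 R).-integrable (slab om) (EFin \o (fun x => q x.1 * (A x.1 * b x.2))).
    have := integrableMl mD qi3 (measurable_funTS (test3_measurable (test3_tensor tA tb))) _.
    apply; exists M; split; first exact: num_real.
    by move=> y My x _; exact: le_trans (AbM x) (ltW My).
  rewrite (@eq_Rintegral _ _ _ (leb3 R) (slab om) (fun x : mspace R =>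
    f x * (A x.1 * b x.2) - q x.1 * (A x.1 * b x.2))); last first.
    by move=> x _; rewrite -mulrBl.
  rewrite RintegralB//; apply/eqP; rewrite subr_eq0; apply/eqP.
  have := ex A b tA tb; rewrite ic0 mul1r => ->.
  have mA : measurable_fun om (A : mplane R -> R).
    by apply: measurable_funTS; exact: test2_measurable tA.
  have qAi : (leb2 R).-integrable om (EFin \o (fun y => q y * A y)).
    have [N AN] := test_function_bounded tA.
    have := integrableMl mom qi mA _; apply; exists N; split; first exact: num_real.
    by move=> y Ny x _; exact: le_trans (AN x) (ltW Ny).
  rewrite [RHS](@eq_Rintegral _ _ _ (leb3 R) (slab om)
    (fun x : mspace R => (q x.1 * A x.1) * b x.2)); last by move=> x _; rewrite mulrA.
  rewrite (Rintegral_slab_tensor (q := fun y => q y * A y))//; last first.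
    by apply: eq_integrable qAb => // x _; rewrite /= mulrA.
  rewrite mulrC; congr (_ * _); rewrite Rintegral_slab12//=.
  have i12 := @integrable_fubini12 _ _ _ _ R (leb2 R) leb om J mom mJ _ fAc.
  apply: ae_eq_Rintegral => //.
  - by apply/measurable_EFinP; exact: measurable_int i12.
  - by apply/measurable_EFinP; exact: measurable_int qAi.
  - have sec := @ae_integrable_section _ _ _ _ R (leb2 R) leb om J mom mJ _ fci.
    apply: aeS sec => y h omy; rewrite -RintegralZr//; last exact: h.
    by apply: eq_Rintegral => t _; rewrite mulrA mulrAC.
exists q; split.
  apply/(L2_cylinder mq); apply: L2_ae_eq L2f => //.
  - exact: measurable_fun_cylinder.
  - by apply: aeS aefq => x h /h /eqP; rewrite subr_eq0 => /eqP.
by apply: aeS aefq => x h /h /eqP; rewrite subr_eq0 => /eqP.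
Qed.

End vanishing_third_derivative_in_a_slab.

Section almost_everywhere_in_the_slab.
Variable R : realType.
Local Notation leb := (@lebesgue_measure R).
Local Notation J := (`]0, 1[%classic : set R).
Implicit Types (om : set (plane R)) (P : plane R -> Prop).

Lemma ae_slab_lift om P : {ae leb2 R, forall x, om x -> P x} ->
  {ae leb3 R, forall x, slab om x -> P x.1}.
Proof.
move=> [N [mN N0 NP]]; exists (N `*` [set: measurableTypeR R]); split.
- exact: measurableX.
- by rewrite /= /leb3 product_measure1E// [X in (X * _)%E]N0 mul0e.
- move=> x /= nx; split => //; apply: NP => /= h; apply: nx => -[+ _].
  exact: h.
Qed.

(** Almost every vertical section of a null set is a null set, hence does not
    contain (0, 1). *)
Lemma ae_slab_descend om P : {ae leb3 R, forall x, slab om x -> P x.1} ->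
  {ae leb2 R, forall x, om x -> P x}.
Proof.
move=> [N [mN N0 NP]].
have mx := measurable_fun_xsection leb mN.
have I0 : (\int[leb2 R]_x `|(leb \o xsection N) x| = 0)%E.
  rewrite -[RHS]N0 /leb3 /product_measure1; apply: eq_integral => x _.
  by rewrite gee0_abs.
have /(ae_eq_integral_abs (leb2 R) measurableT mx) := I0.
apply: aeS => x /= /(_ I) xN0 omx; apply: contrapT => nPx.
have JN : J `<=` xsection N x.
  move=> t Jt; rewrite /xsection/= inE; apply: NP => /= h; apply: nPx.
  exact: (h (conj omx Jt)).
have : (leb J <= leb (xsection N x))%E.
  apply: le_measure => //; rewrite inE; first exact: measurable_itv.
  exact: measurable_xsection.
by rewrite [X in (_ <= X)%E]xN0 [X in (X <= _)%E]leb_unit_itv lee_fin ler10.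
Qed.

End almost_everywhere_in_the_slab.

(** * Measurability of a continuous function of a field *)

Section measurability_of_a_continuous_function_of_a_field.
Variable R : realType.

(** The point x of space as a row vector. *)
Definition row3 (x : space R) : 'rV[R]_3 :=
  \row_j (if j == k1 then x.1.1 else if j == k2 then x.1.2 else x.2).

Lemma row3_continuous : continuous row3.
Proof.
move=> x; apply/cvg_ballP => e e0.
have : nbhs x (ball x e) by exact: nbhsx_ballx.
apply: filterS => y [[h1 h2] h3]; split => // i j; rewrite !mxE.
by case: ifP => _ //; case: ifP.
Qed.

Lemma row3_coord (v : 'rV[R]_3) : row3 (v 0 k1, v 0 k2, v 0 k3) = v.
Proof.
apply/rowP => j; rewrite mxE; by case: (ord3_cases j) => ->.
Qed.

Lemma measurable_continuous_field d (T : measurableType d) (D : set T)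
    (m : T -> 'rV[R]_3) (phi : 'rV[R]_3 -> R) :
  measurable D -> (forall j, measurable_fun D (fun x => m x 0 j)) ->
  continuous phi -> measurable_fun D (fun x => phi (m x)).
Proof.
move=> mD mm cphi; apply: measurable_fun_open_preimage => // U oU.
have oW : open ((phi \o row3) @^-1` U).
  have /continuousP : continuous (phi \o row3).
    by move=> x; apply: continuous_comp; [exact: row3_continuous|exact: cphi].
  exact.
have [l [r [_ WE]]] := open_box_cover oW.
pose B n := D `&` (fun x => m x 0 k1) @^-1` `](l n).1.1, (r n).1.1[ `&`
  (D `&` (fun x => m x 0 k2) @^-1` `](l n).1.2, (r n).1.2[) `&`
  (D `&` (fun x => m x 0 k3) @^-1` `](l n).2, (r n).2[).
have -> : D `&` (fun x => phi (m x)) @^-1` U = \bigcup_n B n.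
  apply/seteqP; split => [x [Dx Ux]|x [n _ [[[Dx h1] [_ h2]] [_ h3]]]].
    have : ((phi \o row3) @^-1` U) (m x 0 k1, m x 0 k2, m x 0 k3).
      by rewrite /preimage/= row3_coord.
    rewrite WE => -[n _ [[h1 h2] h3]]; exists n => //.
  split => //; rewrite /preimage/= -(row3_coord (m x)).
  suff : ((phi \o row3) @^-1` U) (m x 0 k1, m x 0 k2, m x 0 k3) by [].
  by rewrite WE; exists n.
apply: bigcupT_measurable => n.
by apply: measurableI; [apply: measurableI|]; apply: mm => //; exact: measurable_itv.
Qed.

End measurability_of_a_continuous_function_of_a_field.

(** * Weak derivatives in the slab and in its cross-section *)

Section weak_derivatives_in_the_slab.
Variable R : realType.
Local Notation leb := (@lebesgue_measure R).
Local Notation J := (`]0, 1[%classic : set R).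
Variable om : set (plane R).
Hypothesis oom : open om.
Implicit Types (f G : space R -> R) (q g : plane R -> R).

Let mom : measurable (om : set (mplane R)).
Proof. exact: open_measurable2. Qed.
Let mD : measurable (slab om : set (mspace R)).
Proof. exact: measurable_slab. Qed.
Let oJ : open J.
Proof. exact: interval_open. Qed.

Lemma distr_der3_k3_tensor (Om : set (space R)) f A c :
  (forall k, Ck (@e2 R) k A) -> smooth1 c ->
  distr_der3 Om k3 f (fun x => A x.1 * c x.2) =
  - \int[leb3 R]_(x in Om) (f x * (A x.1 * 'D_1 c x.2)).
Proof.
move=> sA sc; congr (- _); apply: eq_Rintegral => x _; congr (_ * _).
by have [_ ->] := is_derive_tensor3_k3 A sc x.
Qed.

Lemma distr_der3_hor_tensor (Om : set (space R)) i f A c :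
  (forall k, Ck (@e2 R) k A) -> smooth1 c ->
  distr_der3 Om (hor i) f (fun x => A x.1 * c x.2) =
  - \int[leb3 R]_(x in Om) (f x * ('D_(e2 R i) A x.1 * c x.2)).
Proof.
move=> sA sc; congr (- _); apply: eq_Rintegral => x _; congr (_ * _).
case: (ord2_cases i) => ->.
  by have [_ ->] := is_derive_tensor3_k1 c sA x.
by have [_ ->] := is_derive_tensor3_k2 c sA x.
Qed.

Lemma vanishing_d3_distr J' om' f :
  (forall psi, test3 (om' `*` J') psi -> distr_der3 (om' `*` J') k3 f psi = 0) ->
  vanishing_d3 om' J' f.
Proof.
move=> f0 A c tA tc; have := f0 _ (test3_tensor tA tc).
rewrite distr_der3_k3_tensor; last 2 first.
- by case: tA.
- by case: tc.
by move/eqP; rewrite oppr_eq0 => /eqP.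
Qed.

(** Horizontal derivatives commute with the third one: if the latter kills f,
    it kills a horizontal weak derivative G of f. *)
Lemma vanishing_d3_weak_der i f G : vanishing_d3 om J f ->
  weak_der3 (slab om) (hor i) f G -> vanishing_d3 om J G.
Proof.
move=> f0 fG A c tA tc; rewrite -(fG _ (test3_tensor tA (test1_derive tc))).
rewrite (@distr_der3_hor_tensor _ i f A ('D_1 c)); last 2 first.
- by case: tA.
- by case: (test1_derive tc).
by rewrite (f0 _ _ (test_function_derive i tA) tc) oppr0.
Qed.

Lemma Rintegral_cylinder_tensor f q A c : L2 (leb3 R) (slab om) f ->
  L2 (leb2 R) om q -> {ae leb3 R, forall x, slab om x -> f x = q x.1} ->
  test2 om A -> test1 J c ->
  \int[leb3 R]_(x in slab om) (f x * (A x.1 * c x.2)) =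
  \int[leb2 R]_(y in om) (q y * A y) * \int[leb]_t c t.
Proof.
move=> L2f L2q fq tA tc; have [mf _] := L2f; have [mq _] := L2q.
have L2q3 := (L2_cylinder oom mq).1 L2q; have [mq3 _] := L2q3.
have L2Ac := test_L2 oom oJ tA tc; have [mAc _] := L2Ac.
rewrite -Rintegral_slab_tensor//; last exact: test2_mul_integrable.
  apply: ae_eq_Rintegral => //.
  - exact: measurable_funM.
  - have := measurable_funM mq3 mAc; apply: eq_measurable_fun => x _.
    by rewrite /= mulrA.
  - by apply: aeS fq => x h /h ->; rewrite mulrA.
by apply: eq_integrable (L2_mul_integrable mD L2q3 L2Ac) => // x _; rewrite /= mulrA.
Qed.

(** Weak derivatives pass from a cylindrical function to its trace: test with
    psi(x') c(x_3), where c has integral 1. *)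
Lemma weak_der_descend i f q G g :
  L2 (leb3 R) (slab om) f -> L2 (leb2 R) om q ->
  {ae leb3 R, forall x, slab om x -> f x = q x.1} ->
  L2 (leb3 R) (slab om) G -> L2 (leb2 R) om g ->
  {ae leb3 R, forall x, slab om x -> G x = g x.1} ->
  weak_der3 (slab om) (hor i) f G -> weak_der2 om i q g.
Proof.
move=> L2f L2q fq L2G L2g Gg fG psi tpsi.
have [c0 [tc0 ic0]] := @test1_unit_mass R 0 1 ltr01.
have := fG _ (test3_tensor tpsi tc0).
rewrite distr_der3_hor_tensor; last 2 first.
- by case: tpsi.
- by case: tc0.
rewrite (Rintegral_cylinder_tensor L2f L2q fq (test_function_derive i tpsi) tc0).
by rewrite (Rintegral_cylinder_tensor L2G L2g Gg tpsi tc0) ic0 !mulr1.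
Qed.

Lemma test3_derive_L2_slab psi i : test3 (slab om) psi ->
  L2 (leb3 R) (slab om) ('D_(@e3 R i) psi).
Proof.
move=> /(test_function_derive i)/test3_L2; exact: L2S.
Qed.

Lemma test3_L2_slab psi : test3 (slab om) psi -> L2 (leb3 R) (slab om) psi.
Proof. by move/test3_L2; exact: L2S. Qed.

(** Weak derivatives pass from the trace to the cylindrical function: every
    slice of a test function is a test function. *)
Lemma weak_der_lift i f q g :
  L2 (leb3 R) (slab om) f -> L2 (leb2 R) om q -> L2 (leb2 R) om g ->
  {ae leb3 R, forall x, slab om x -> f x = q x.1} ->
  weak_der2 om i q g -> weak_der3 (slab om) (hor i) f (fun x => g x.1).
Proof.
move=> L2f L2q L2g fq qg psi tpsi; have [mf _] := L2f.
have [mq _] := L2q; have [mg _] := L2g.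
have L2q3 := (L2_cylinder oom mq).1 L2q; have [mq3 _] := L2q3.
have L2g3 := (L2_cylinder oom mg).1 L2g.
have L2D := test3_derive_L2_slab (hor i) tpsi; have [mDp _] := L2D.
have E : \int[leb3 R]_(x in slab om) (f x * 'D_(@e3 R (hor i)) psi x) =
    \int[leb3 R]_(x in slab om) (q x.1 * 'D_(@e3 R (hor i)) psi x).
  apply: ae_eq_Rintegral => //; [exact: measurable_funM|exact: measurable_funM|].
  by apply: aeS fq => x h /h ->.
rewrite /distr_der3 E Rintegral_slab21//; last exact: L2_mul_integrable.
have gpsi : (leb3 R).-integrable (slab om) (EFin \o (fun x => g x.1 * psi x)).
  by apply: L2_mul_integrable => //; exact: test3_L2_slab.
rewrite Rintegral_slab21//.
have h t : \int[leb2 R]_(y in om) (q y * 'D_(@e3 R (hor i)) psi (y, t)) =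
   - \int[leb2 R]_(y in om) (g y * psi (y, t)).
  rewrite -(qg _ (test2_slice t tpsi)) /distr_der2 opprK.
  apply: eq_Rintegral => y _; congr (_ * _).
  by have [_ ->] := derive_slice i psi y t.
under eq_Rintegral => t _ do rewrite /= h -mulN1r.
rewrite RintegralZl ?mulN1r ?opprK//.
exact: (@integrable_fubini21 _ _ _ _ R (leb2 R) leb om J mom (measurable_itv _) _ gpsi).
Qed.

(** On each vertical line the third derivative of a test function integrates
    to zero. *)
Lemma cylinder_d3 f q psi : L2 (leb3 R) (slab om) f -> L2 (leb2 R) om q ->
  {ae leb3 R, forall x, slab om x -> f x = q x.1} ->
  test3 (slab om) psi -> distr_der3 (slab om) k3 f psi = 0.
Proof.
move=> L2f L2q fq tpsi; have [mf _] := L2f; have [mq _] := L2q.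
have L2q3 := (L2_cylinder oom mq).1 L2q; have [mq3 _] := L2q3.
have L2D := test3_derive_L2_slab k3 tpsi; have [mDp _] := L2D.
have E : \int[leb3 R]_(x in slab om) (f x * 'D_(@e3 R k3) psi x) =
    \int[leb3 R]_(x in slab om) (q x.1 * 'D_(@e3 R k3) psi x).
  apply: ae_eq_Rintegral => //; [exact: measurable_funM|exact: measurable_funM|].
  by apply: aeS fq => x h /h ->.
rewrite /distr_der3 E Rintegral_slab12//; last exact: L2_mul_integrable.
have [_ [K [_ KD psi0]]] := tpsi.
have inner y : \int[leb]_(t in J) (q y * 'D_(@e3 R k3) psi (y, t)) = 0.
  pose u t := 'D_(@e3 R k3) psi (y, t).
  have cu : continuous u.
    move=> t; apply: (@continuous_comp _ _ _ (fun t => (y, t)) ('D_(@e3 R k3) psi)).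
      apply: (@cvg_pair _ _ _ (nbhs t) (nbhs y) (nbhs t)); last exact: cvg_id.
      exact: cvg_cst.
    have [cD _] := test_function_derive k3 tpsi; exact: (Ck_continuous (cD 0%N)).
  have du t : is_derive t (1 : R) (fun t => psi (y, t)) (u t).
    by apply: is_derive_slice_snd; apply: Ck_derivable; case: tpsi.
  have ui : leb.-integrable `[0, 1] (EFin \o u).
    by apply: continuous_compact_integrable; [exact: segment_compact|exact: continuous_subspaceT].
  have u01 : \int[leb]_(t in `[0, 1]) u t = 0.
    have nK t : ~ J t -> psi (y, t) = 0.
      by move=> nJ; apply: psi0 => Kt; apply: nJ; have [] := KD _ Kt.
    have [p1 p0] : psi (y, 1) = 0 /\ psi (y, 0) = 0.
      by split; apply: nK; rewrite /= in_itv/= ltxx ?andbF.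
    rewrite /Rintegral (@continuous_FTC2 _ u (fun t => psi (y, t)))//.
    - by rewrite p1 p0 -EFinB subrr.
    - exact: continuous_subspaceT.
    - have cpsi : continuous (fun t => psi (y, t)).
        move=> t; apply: differentiable_continuous; apply/derivable1_diffP.
        by have [] := du t.
      split; first by move=> t _; have [] := du t.
      + exact: cvg_at_right_filter (cpsi 0).
      + exact: cvg_at_left_filter (cpsi 1).
    - by move=> t _; rewrite derive1E; have [_ ->] := du t.
  have ui' : leb.-integrable J (EFin \o u).
    by apply: integrableS ui => //; exact: subset_itv_oo_cc.
  rewrite RintegralZl//.
  rewrite Rintegral_itv_bndo_bndc// Rintegral_itv_obnd_cbnd//.
    by rewrite u01 mulr0.
  by apply: integrableS ui => //; exact: subset_itv_oc_cc.
by under eq_Rintegral do rewrite /= inner; rewrite Rintegral_cst// mul0r oppr0.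
Qed.

Lemma weak_der3_unique i f G1 G2 :
  L2 (leb3 R) (slab om) G1 -> L2 (leb3 R) (slab om) G2 ->
  weak_der3 (slab om) i f G1 -> weak_der3 (slab om) i f G2 ->
  {ae leb3 R, forall x, slab om x -> G1 x = G2 x}.
Proof.
move=> L21 L22 w1 w2; have L2d := L2B mD L21 L22.
have : {ae leb3 R, forall x, slab om x -> G1 x - G2 x = 0}.
  apply: cutoff_integrals_eq0.
  - exact: open_setX.
  - by have [] := L2d.
  - by move=> l r; apply: L2_box_integrable.
  - move=> l r s lrD lr0 s0; have [tA tb] := cutoff3_tensor lrD lr0 s0.
    have tpsi := test3_tensor tA tb.
    have L2p := test3_L2_slab tpsi.
    have /eqP := w1 _ tpsi; rewrite (w2 _ tpsi) eq_sym -subr_eq0 => /eqP <-.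
    rewrite -RintegralB//; [|exact: L2_mul_integrable..].
    by apply: eq_Rintegral => x _; rewrite -mulrBl.
by apply: aeS => x h /h /eqP; rewrite subr_eq0 => /eqP.
Qed.

End weak_derivatives_in_the_slab.

(** * The reduced domain and the reduced energy *)

Section reduction_of_the_limit.
Variable R : realType.
Local Notation leb := (@lebesgue_measure R).
Local Notation J := (`]0, 1[%classic : set R).
Variables (om : set (plane R)) (ms : R).
Hypotheses (oom : open om) (om_fin : (leb2 R om < +oo)%E).
Implicit Types (p : field3 R * field3 R) (q : field2 R * field2 R).

Let mom : measurable (om : set (mplane R)).
Proof. exact: open_measurable2. Qed.
Let mD : measurable (slab om : set (mspace R)).
Proof. exact: measurable_slab. Qed.

Lemma slabE (x : space R) : slab om x <-> om x.1 /\ 0 < x.2 < 1.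
Proof. by rewrite /slab /setX/= in_itv. Qed.

Lemma ext0_coord (T : Type) (Om : set T) (m : T -> 'rV[R]_3) x j :
  ext0 Om m x 0 j = ((fun x => m x 0 j) \_ Om) x.
Proof. by rewrite /ext0 patchE; case: ifP => //; rewrite mxE. Qed.

Lemma slab_setT : slab [set: plane R] = [set x : space R | 0 < x.2 < 1].
Proof. by apply/seteqP; split => x; rewrite /slab /setX/= in_itv//= => -[]. Qed.

(** The field h = -(0, 0, m_3), with m_3 extended by zero. *)
Definition hfield (m : field2 R) : field2 R := fun y =>
  \row_j (if j == k3 then - ext0 om m y 0 k3 else 0).

Lemma hfieldE m y j :
  hfield m y 0 j = if j == k3 then - ext0 om m y 0 k3 else 0.
Proof. by rewrite mxE. Qed.

Lemma L2_ext0 d (T : measurableType d) (mu : {measure set T -> \bar R})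
    (Om : set T) (m : T -> 'rV[R]_3) j : measurable Om ->
  L2vec mu Om m -> L2 mu setT (fun x => ext0 Om m x 0 j).
Proof.
move=> mOm /(_ j)[mm mi]; under eq_fun do rewrite ext0_coord; split.
  exact/(measurable_restrictT _ _).1.
move: mi; rewrite integral_mkcond; congr (_ < _)%E; apply: eq_integral => x _.
by rewrite !patchE; case: ifP => //; rewrite expr0n.
Qed.

Lemma ext0_slab (m : field3 R) (m' : field2 R) (x : space R) :
  (slab om x -> m x = m' x.1) -> 0 < x.2 < 1 ->
  ext0 (slab om) m x = ext0 om m' x.1.
Proof.
move=> mm' x01; rewrite /ext0; have [ox|nox] := pselect (om x.1).
  have sx : slab om x by apply/slabE.
  by rewrite !mem_set// mm'.
by rewrite !memNset// => /slabE[].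
Qed.

Lemma ext0_out (m : field3 R) (x : space R) :
  ~~ (0 < x.2 < 1) -> ext0 (slab om) m x = 0.
Proof. by move=> x01; rewrite /ext0 memNset// => /slabE[_]; apply/negP. Qed.

Lemma dd_ae0 i (f : space R -> R) psi :
  {ae leb3 R, forall x, f x = 0} -> measurable_fun [set: mspace R] f ->
  test3 setT psi -> dd i f psi = 0.
Proof.
move=> f0 mf tpsi; rewrite /dd /distr_der3.
have mp := test3_measurable (test_function_derive i tpsi).
rewrite (@ae_eq_Rintegral _ _ _ (leb3 R) setT _ (cst 0)) ?Rintegral_cst ?mul0r ?oppr0//.
  exact: measurable_funM.
by apply: aeS f0 => x -> _; rewrite mul0r.
Qed.

(** For a pair (m, h) in U_0, h is determined by m: the functions h_1, h_2 and
    m_3 + h_3 are square integrable on space with vanishing third derivative,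
    hence zero. *)
Lemma U_0_field p : U_0 om ms p ->
  {ae leb3 R, forall x, forall j,
     p.2 x 0 j = if j == k3 then - ext0 (slab om) p.1 x 0 k3 else 0}.
Proof.
move=> [[[L2m _] L2h] eqs _ _].
have z (f : space R -> R) : L2 (leb3 R) setT f ->
    (forall psi, test3 setT psi -> dd k3 f psi = 0) ->
    {ae leb3 R, forall x, f x = 0}.
  move=> L2f f0; apply: vanishing_d3_whole_space => //.
  apply: vanishing_d3_distr => psi; rewrite setXTT; exact: f0.
have z1 := z _ (L2h k1) (fun psi t => let: And4 _ _ h _ := eqs psi t in h).
have z2 := z _ (L2h k2) (fun psi t => let: And4 _ h _ _ := eqs psi t in h).
have z3 := z _ (L2D measurableT (L2_ext0 k3 mD L2m) (L2h k3))
  (fun psi t => let: And4 h _ _ _ := eqs psi t in h).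
apply: (aeS2 _ (aeS2 (fun x a b => conj a b) z1 z2) z3) => x [a b] c j.
case: (ord3_cases j) => -> //=.
by apply/eqP; rewrite -addr_eq0 addrC; apply/eqP.
Qed.

Lemma U_0_tU_0 p q : U_0 om ms p -> X2 om q -> identified om q p -> tU_0 om ms q.
Proof.
move=> Up Xq [id1 id2]; have hp := U_0_field Up; have [_ _ _ nm] := Up; split => //.
  apply: ae_slab_descend; apply: aeS2 id1 nm => x a b sx.
  by rewrite -(a sx); exact: b.
have : {ae leb3 R, forall x, slab [set: plane R] x ->
    q.2 x.1 = \row_j (if j == k3 then - ext0 om q.1 x.1 0 k3 else 0)}.
  apply: (aeS2 _ (aeS2 (fun x a b => conj a b) id1 id2) hp) => x [a b] c.
  rewrite slab_setT => /= x01; move: b; rewrite x01 => <-.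
  by apply/rowP => j; rewrite c mxE (ext0_slab a x01).
move=> h; have := @ae_slab_descend _ setT
  (fun y => q.2 y = \row_j (if j == k3 then - ext0 om q.1 y 0 k3 else 0)) h.
by apply: aeS => y; exact.
Qed.

Lemma tU_0_U_0 p q : tU_0 om ms q -> X3 om p -> identified om q p -> U_0 om ms p.
Proof.
move=> [[[L2q1 _] L2q2] nm hq] Xp [id1 id2]; have [[L2p1 _] L2p2] := Xp.
have hq' : {ae leb3 R, forall x, slab [set: plane R] x ->
    q.2 x.1 = hfield q.1 x.1}.
  by apply: (@ae_slab_lift _ setT (fun y => q.2 y = hfield q.1 y)); apply: aeS hq => y ->.
have hp : {ae leb3 R, forall x, forall j,
     p.2 x 0 j = if j == k3 then - ext0 (slab om) p.1 x 0 k3 else 0}.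
  apply: (aeS2 _ (aeS2 (fun x a b => conj a b) id1 id2) hq') => x [a b] c j.
  rewrite b; case: ifPn => x01; last first.
    by rewrite ext0_out// !mxE oppr0 if_same.
  by rewrite c ?slab_setT// hfieldE (ext0_slab a x01).
have mp j : measurable_fun [set: mspace R] (fun x => p.2 x 0 j) by have [] := L2p2 j.
have mm j : measurable_fun [set: mspace R] (fun x => ext0 (slab om) p.1 x 0 j).
  by have [] := L2_ext0 j mD L2p1.
have h1 : {ae leb3 R, forall x, p.2 x 0 k1 = 0} by apply: aeS hp => x ->.
have h2 : {ae leb3 R, forall x, p.2 x 0 k2 = 0} by apply: aeS hp => x ->.
split => //.
- move=> psi tpsi; split.
  + apply: dd_ae0 => //; last exact: measurable_funD.
    by apply: aeS hp => x ->; rewrite subrr.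
  + exact: dd_ae0.
  + exact: dd_ae0.
  + by rewrite !dd_ae0// subrr.
- move=> psi tpsi j; apply: (@cylinder_d3 _ _ oom _ (fun y => q.1 y 0 j)) => //.
  by apply: aeS id1 => x h /h ->.
- by apply: aeS2 (ae_slab_lift nm) id1 => x a b sx; rewrite (b sx); exact: a.
Qed.

Lemma hfield_L2 m : L2vec (leb2 R) om m -> L2vec (leb2 R) setT (hfield m).
Proof.
move=> L2m j; under eq_fun do rewrite hfieldE; case: (j == k3).
  under eq_fun do rewrite -mulN1r; apply: L2Z => //; exact: L2_ext0.
have := L2Z measurableT 0 (L2_ext0 j mom L2m).
by congr L2; apply/funext => x; rewrite mul0r.
Qed.

(** Every pair in U_0 is identified with a two-dimensional one. *)
Lemma U_0_cylinder p : U_0 om ms p -> exists q, X2 om q /\ identified om q p.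
Proof.
move=> Up; have hp := U_0_field Up; have [[[L2m wm] L2h] _ d3 _] := Up.
have van j : vanishing_d3 om J (fun x => p.1 x 0 j).
  by apply: vanishing_d3_distr => psi tpsi; exact: d3.
have /choice[m mP] j := slab_cylinder oom om_fin (L2m j) (van j).
pose q1 : field2 R := fun y => \row_j m j y.
have q1E j : (fun y => q1 y 0 j) = m j by apply/funext => y; rewrite mxE.
have L2q1 : L2vec (leb2 R) om q1 by move=> j; rewrite q1E; have [] := mP j.
exists (q1, hfield q1); split; first split => //=.
- split => // i j; have [G L2G wG] := wm (hor i) j.
  have vG := vanishing_d3_weak_der (van j) wG.
  have [g [L2g Gg]] := slab_cylinder oom om_fin L2G vG.
  exists g => //; rewrite q1E; have [L2mj mj] := mP j.
  exact: (weak_der_descend oom (L2m j) L2mj mj L2G L2g Gg wG).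
- exact: hfield_L2.
have id1 : {ae leb3 R, forall x, slab om x -> p.1 x = q1 x.1}.
  have [[_ a] [_ b] [_ c]] := And3 (mP k1) (mP k2) (mP k3).
  apply: (aeS2 _ (aeS2 (fun x u v => conj u v) a b) c) => x [a' b'] c' sx.
  apply/rowP => j; rewrite mxE.
  by case: (ord3_cases j) => ->; [exact: a'|exact: b'|exact: c'].
split => //=; apply: aeS2 id1 hp => x a b; apply/rowP => j; rewrite b.
case: ifP => [/eqP ->|jk3]; case: ifPn => x01; rewrite ?hfieldE ?jk3 ?eqxx ?mxE//.
- by rewrite (ext0_slab a x01).
- by rewrite ext0_out// mxE oppr0.
Qed.

Lemma U_0_embed : U_0 om ms = embed om (tU_0 om ms).
Proof.
apply/seteqP; split => p.
  move=> Up; have [Xp _ _ _] := Up; split => //.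
  have [q [Xq iqp]] := U_0_cylinder Up; exists q => //.
  exact: U_0_tU_0 Xq iqp.
by move=> [Xp [q tq iqp]]; exact: tU_0_U_0 tq Xp iqp.
Qed.

(** The representative chosen by wpartial is a weak derivative in L^2. *)
Lemma wpartialP d (T : measurableType d) (mu : {measure set T -> \bar R})
    (Om : set T) n (wd : 'I_n -> (T -> R) -> (T -> R) -> Prop)
    (m : T -> 'rV[R]_3) i j :
  W12vec mu Om wd m ->
  L2 mu Om (wpartial mu Om wd i (fun x => m x 0 j)) /\
  wd i (fun x => m x 0 j) (wpartial mu Om wd i (fun x => m x 0 j)).
Proof.
move=> [_ /(_ i j)[g L2g wg]].
have := @xgetPex _ (fun=> 0)
  [set g | L2 mu Om g /\ wd i (fun x => m x 0 j) g] (ex_intro _ g (conj L2g wg)).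
by [].
Qed.

(** The chosen horizontal derivatives in the slab and in om agree, by
    uniqueness of weak derivatives. *)
Lemma pd3_pd2 p q i j : X2 om q -> X3 om p ->
  {ae leb3 R, forall x, slab om x -> p.1 x = q.1 x.1} ->
  {ae leb3 R, forall x, slab om x ->
     pd3 (slab om) p.1 (hor i) j x = pd2 om q.1 i j x.1}.
Proof.
move=> [Wq _] [Wp _] pq; have [L2q _] := Wq; have [L2p _] := Wp.
have [L2g wg] := wpartialP i j Wq; have [L2G wG] := wpartialP (hor i) j Wp.
have pqj : {ae leb3 R, forall x, slab om x -> p.1 x 0 j = q.1 x.1 0 j}.
  by apply: aeS pq => x h /h ->.
have [mg _] := L2g.
apply: (weak_der3_unique oom L2G _ wG); first exact/(L2_cylinder oom mg).
exact: (weak_der_lift oom (L2p j) (L2q j) L2g pqj wg).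
Qed.

Lemma enorm_sqr (v : 'rV[R]_3) : enorm v ^+ 2 = \sum_(j < 3) v 0 j ^+ 2.
Proof. by rewrite sqr_sqrtr//; apply: sumr_ge0 => j _; exact: sqr_ge0. Qed.

Lemma F_0_tF_0 (alpha : R) (phi : 'rV[R]_3 -> R) p q : 0 < alpha -> (forall v, 0 <= phi v) ->
  continuous phi -> X2 om q -> X3 om p -> identified om q p ->
  F_0 om alpha ms phi p = tF_0 om alpha ms phi q.
Proof.
move=> a0 phi0 cphi Xq Xp idqp; rewrite /F_0 /tF_0.
have UE : U_0 om ms p <-> tU_0 om ms q.
  by split=> [Up|tq]; [exact: U_0_tU_0 Up Xq idqp|exact: tU_0_U_0 tq Xp idqp].
have [Up|nUp] := pselect (U_0 om ms p); last first.
  by rewrite !asboolF// => /UE.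
rewrite !asboolT//; last exact/UE.
have hp := U_0_field Up; have [id1 id2] := idqp.
have [[L2q _] _] := Xq; have [[L2p _] L2h] := Xp.
pose g2 (y : plane R) := \sum_(i < 2) \sum_(j < 3) pd2 om q.1 i j y ^+ 2.
pose g3 (x : space R) := \sum_(j < 3) (pd3 (slab om) p.1 k1 j x ^+ 2
                               + pd3 (slab om) p.1 k2 j x ^+ 2).
have m2 i j : measurable_fun om (pd2 om q.1 i j : mplane R -> R).
  by have [[? _] _] := wpartialP i j Xq.1.
have m3 i j : measurable_fun (slab om) (pd3 (slab om) p.1 i j : mspace R -> R).
  by have [[? _] _] := wpartialP i j Xp.1.
pose H (y : plane R) := alpha * g2 y + phi (q.1 y).
have H0 y : 0 <= H y.
  rewrite addr_ge0// mulr_ge0 ?(ltW a0)//.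
  by apply: sumr_ge0 => i _; apply: sumr_ge0 => j _; exact: sqr_ge0.
have mH : measurable_fun om (H : mplane R -> R).
  apply: measurable_funD.
    apply: measurable_funM => //; apply: measurable_sum => i.
    by apply: measurable_sum => j; apply: measurable_funX; exact: m2.
  by apply: measurable_continuous_field => // j; have [] := L2q j.
have mq3 : measurable_fun om (fun y : mplane R => q.1 y 0 k3) by have [] := L2q k3.
have E1 : (\int[leb3 R]_(x in slab om) (alpha * g3 x + phi (p.1 x))%:E =
           \int[leb2 R]_(y in om) (H y)%:E)%E.
  rewrite -ge0_integral_slab//; apply: ge0_ae_eq_integral => //.
  - apply/measurable_EFinP; apply: measurable_funD.
      apply: measurable_funM => //; apply: measurable_sum => j.
      by apply: measurable_funD; apply: measurable_funX; exact: m3.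
    by apply: measurable_continuous_field => // j; have [] := L2p j.
  - by apply/measurable_EFinP; exact: (measurable_fun_cylinder oom mH).
  - move=> x _; rewrite lee_fin addr_ge0// mulr_ge0 ?(ltW a0)//.
    by apply: sumr_ge0 => j _; rewrite addr_ge0// sqr_ge0.
  - by move=> x _; rewrite lee_fin.
  - have e i j := @pd3_pd2 p q i j Xq Xp id1.
    pose c (P Q : space R -> Prop) := @aeS2 _ _ _ (leb3 R) P Q _ (fun x a b => conj a b).
    have ea i := c _ _ (e i k1) (c _ _ (e i k2) (e i k3)).
    apply: aeS (c _ _ id1 (c _ _ (ea ord0) (ea ord_max))).
    move=> x [e0 [[a1 [a2 a3]] [b1 [b2 b3]]]] sx; congr (_%:E).
    rewrite /H /g3 /g2 (e0 sx); congr (_ * _ + _).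
    rewrite exchange_big; apply: eq_bigr => j _.
    rewrite big_ord_recl big_ord1 (_ : lift ord0 ord0 = ord_max); last exact: val_inj.
    by case: (ord3_cases j) => ->; congr (_ ^+ 2 + _ ^+ 2);
      [exact: a1|exact: b1|exact: a2|exact: b2|exact: a3|exact: b3].
have E2 : (\int[leb3 R]_x (enorm (p.2 x) ^+ 2)%:E =
           \int[leb2 R]_(y in om) (q.1 y 0 k3 ^+ 2)%:E)%E.
  rewrite -(@ge0_integral_slab _ _ oom (fun y => q.1 y 0 k3 ^+ 2)); last 2 first.
  - exact: measurable_funX.
  - by move=> y _; exact: sqr_ge0.
  under eq_integral do rewrite enorm_sqr.
  rewrite [RHS]integral_mkcond; apply: ge0_ae_eq_integral => //.
  - apply/measurable_EFinP.
    by apply: measurable_sum => j; apply: measurable_funX; have [] := L2h j.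
  - apply/(measurable_restrictT _ _).1 => //; apply/measurable_EFinP.
    exact: (measurable_fun_cylinder oom (measurable_funX 2 mq3)).
  - by move=> x _; rewrite lee_fin; apply: sumr_ge0 => j _; exact: sqr_ge0.
  - by move=> x _; rewrite patchE; case: ifP => // _; rewrite lee_fin sqr_ge0.
  - apply: aeS2 id1 hp => x a b _.
    rewrite !big_ord_recl big_ord0 !b/= expr0n/= addr0 !add0r sqrrN.
    rewrite ext0_coord !patchE.
    by case: ifPn => [/set_mem sx|_]; [rewrite a|rewrite expr0n].
have q30 (y : mplane R) : om y -> (0 <= (q.1 y 0 k3 ^+ 2)%:E)%E.
  by rewrite lee_fin sqr_ge0.
have mq32 : measurable_fun om (fun y : mplane R => (q.1 y 0 k3 ^+ 2)%:E).
  by apply/measurable_EFinP; exact: measurable_funX.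
have Zl : ((2^-1)%:E * \int[leb2 R]_(y in om) (q.1 y 0 k3 ^+ 2)%:E =
    \int[leb2 R]_(y in om) ((2^-1)%:E * (q.1 y 0 k3 ^+ 2)%:E))%E.
  by rewrite ge0_integralZl_EFin// invr_ge0.
rewrite E1 E2 Zl -ge0_integralD//.
- by move=> y _; rewrite lee_fin.
- exact/measurable_EFinP.
- by move=> y omy; rewrite mule_ge0 ?lee_fin ?invr_ge0 ?sqr_ge0.
- exact: emeasurable_funM.
Qed.

End reduction_of_the_limit.

Theorem mainTheorem2 (R : realType) (om : set (plane R)) (alpha ms : R)
    (phi : 'rV[R]_3 -> R)
    (om_open : open om) (om_connected : connected om)
    (om_bounded : bounded_set om) (om_area : leb2 R om = 1%E)
    (alpha_gt0 : 0 < alpha) (ms_gt0 : 0 < ms)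
    (phi_ge0 : forall v, 0 <= phi v) (phi_cont : continuous phi)
    (phi_even : forall v, phi (- v) = phi v) :
  [/\ U_0 om ms = embed om (tU_0 om ms),
      (forall q p, X2 om q -> X3 om p -> identified om q p ->
         F_0 om alpha ms phi p = tF_0 om alpha ms phi q),
      (forall p, X3 om p ->
         F_0 om alpha ms phi p = tF_0_embed om alpha ms phi p) &
      (Gamma_limit om (F_eps om alpha ms phi) (F_0 om alpha ms phi) <->
       Gamma_limit om (F_eps om alpha ms phi) (tF_0_embed om alpha ms phi))].
Proof.
have om_fin : (leb2 R om < +oo)%E by rewrite [X in (X < _)%E]om_area ltry.
have FE q p : X2 om q -> X3 om p -> identified om q p ->
    F_0 om alpha ms phi p = tF_0 om alpha ms phi q by exact: F_0_tF_0.
have FE' p : X3 om p -> F_0 om alpha ms phi p = tF_0_embed om alpha ms phi p.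
  move=> Xp; rewrite /tF_0_embed; case: pselect => [e|ne].
    by case: (cid e) => q [Xq iqp] /=; exact: FE.
  rewrite /F_0 asboolF// => Up; apply: ne; exact: U_0_cylinder Up.
split => //; first exact: U_0_embed.
split=> G eps eps0 epscvg p Xp; have [liminf [u [Xu up Fu]]] := G eps eps0 epscvg p Xp.
  by rewrite -FE'//; split => //; exists u.
by rewrite FE'//; split => //; exists u.
Qed.
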